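(* Let $Q(\underline{x}) = x_1^2 + x_1x_2 + x_2^2 - x_3^2$ and $F = \{\underline{x}\in\mathbb{Z}^3 : x_1,x_2,x_3>0\}$. Then: (1) The five matrices $$N_1=\begin{bmatrix}-3&1&4\\-4&-1&4\\-6&0&7\end{bmatrix},\quad N_2=\begin{bmatrix}4&1&4\\3&-1&4\\6&0&7\end{bmatrix},\quad N_3=\begin{bmatrix}4&3&4\\3&4&4\\6&6&7\end{bmatrix},\quad N_4=\begin{bmatrix}-1&3&4\\1&4&4\\0&6&7\end{bmatrix},\quad N_5=\begin{bmatrix}-1&-4&4\\1&-3&4\\0&-6&7\end{bmatrix}$$ together with the base triples $(5,3,7)^T,(3,5,7)^T,(7,8,13)^T,(8,7,13)^T$ form a matrix generating system for the primitive solutions of $Q(\underline{x})=0$ in $F$. (2) Under the projection map $\pi(x,y)=\frac{y}{x+1}$, $\pi^{-1}(t)=\left(\frac{1-t^2}{1+t+t^2},\frac{t^2+2t}{1+t+t^2}\right)$, the 1-dimensional dynamical system corresponding to this generating system is conjugate to the map on $(0,1)$ (defined off finitely many points) $$T_2(t)=\begin{cases}\frac{t}{1-3t}& t\in(0,\frac14),\\ \frac{1-3t}{t}& t\in(\frac14,\frac13),\\ \frac{3t-1}{1-2t}& t\in(\frac13,\frac25),\\ \frac{1-2t}{3t-1}& t\in(\frac25,\frac12),\\ \frac{2t-1}{t}& t\in(\frac12,1).\end{cases}$$ (3) The measure $d\mu=\frac{1}{t(1-t)}\,dt$ on $(0,1)$ is $\sigma$-finite, $T_2$-invariant, ergodic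 and conservative.
   Context: A solution $(a,b,c)^T\in\mathbb{Z}^3$ of $Q=0$ is primitive if $a,b,c$ have no common divisor greater than $1$. Matrix generating system: matrices $N_1,\dots,N_k$ and a finite set of base triples form a matrix generating system for the primitive solutions in $F$ if the vectors $N_{a_1}N_{a_2}\cdots N_{a_n}\underline{b}$ ($n\ge 0$, $a_j\in\{1,\dots,k\}$, $\underline b$ a base triple) are exactly the primitive solutions of $Q=0$ in $F$, and every primitive solution in $F$ has exactly one representation of this form (unique $n$, $a_1,\dots,a_n$ and $\underline b$). Corresponding 1-dimensional system: let $\mathcal{E}=\{(x,y)\in\mathbb{R}^2: Q(x,y,1)=0\}$ and let $FA\subset\mathcal{E}$ be the arc of points $(x,y)$ with $x,y>0$. A matrix $A$ preserving $Q$ acts on points $(x,y)$ of $\mathcal{E}$ by $\widehat{A}(x,y)=(v_1/v_3,v_2/v_3)$ where $(v_1,v_2,v_3)^T=A(x,y,1)^T$. Put $\mathcal{D}_i=FA\cap\widehat{N_i}(FA)$; these sets are pairwise disjoint and cover $FA$ up to finitely many points. The system is the map $\widehat{T}$ on $FA$ (defined off finitely many points) given by $\widehat T=\widehat{N_i^{-1}}$ on $\mathcal{D}_i$. Conjugate under $\pi$ means that $\pi: FA\to(0,1)$ is a homeomorphism and $T_2=\pi\circ\widehat T\circ\pi^{-1}$ off finitely many points. A measure $\mu$ is $T$-invariant if $\mu(T^{-1}A)=\mu(A)$ for all Borel $A$; ergodic if $T^{-1}A=A$ implies $\mu(A)=0$ or $\mu(A^c)=0$; conservative if there is no set $W$ of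 positive measure with $W,T^{-1}W,T^{-2}W,\dots$ pairwise disjoint. Statements about $T$ are understood off the Lebesgue-null set of points where some iterate is undefined. *)

(* Defs.v *)
From HB Require Import structures.
From mathcomp Require Import all_boot all_order all_algebra.
From mathcomp Require Import all_classical all_reals all_analysis.
From mathcomp Require Import measurable_realfun.

Set Implicit Arguments.
Unset Strict Implicit.
Unset Printing Implicit Defensive.

Import Order.TTheory GRing.Theory Num.Theory.
Import numFieldNormedType.Exports.

Local Open Scope classical_set_scope.
Local Open Scope ring_scope.

Definition vec3 (K : Type) (a b c : K) : 'cV[K]_3 :=
  \col_(i < 3) nth a [:: a; b; c] i.

Definition mat3 (K : pzRingType) (rows : seq (seq K)) : 'M[K]_3 :=
  \matrix_(i < 3, j < 3) nth 0 (nth [::] rows i) j.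

Definition Q (K : pzRingType) (v : 'cV[K]_3) : K :=
  v 0 0 ^+ 2 + v 0 0 * v 1 0 + v 1 0 ^+ 2 - v 2 0 ^+ 2.

Definition F : set 'cV[int]_3 :=
  [set v | [/\ 0 < v 0 0, 0 < v 1 0 & 0 < v 2 0]].

Definition primitive (v : 'cV[int]_3) : Prop :=
  forall d : int, 1 < d -> ~ (forall i : 'I_3, (d %| v i 0%R)%Z).

Definition primitive_solution (E : set 'cV[int]_3) : set 'cV[int]_3 :=
  [set v | [/\ E v, Q v = 0 & primitive v]].

Definition word_vec (k : nat) (N : 'I_k -> 'M[int]_3)
    (w : seq 'I_k) (b : 'cV[int]_3) : 'cV[int]_3 :=
  (\prod_(a <- w) N a) *m b.

Definition matrix_generating_system (k : nat) (N : 'I_k -> 'M[int]_3)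
    (base : seq 'cV[int]_3) (E : set 'cV[int]_3) : Prop :=
  (forall w b, b \in base -> primitive_solution E (word_vec N w b)) /\
  (forall v, primitive_solution E v ->
     exists! wb : seq 'I_k * 'cV[int]_3,
       wb.2 \in base /\ word_vec N wb.1 wb.2 = v).

Definition N1 : 'M[int]_3 := mat3 [:: [:: -3; 1; 4]; [:: -4; -1; 4]; [:: -6; 0; 7]].
Definition N2 : 'M[int]_3 := mat3 [:: [:: 4; 1; 4]; [:: 3; -1; 4]; [:: 6; 0; 7]].
Definition N3 : 'M[int]_3 := mat3 [:: [:: 4; 3; 4]; [:: 3; 4; 4]; [:: 6; 6; 7]].
Definition N4 : 'M[int]_3 := mat3 [:: [:: -1; 3; 4]; [:: 1; 4; 4]; [:: 0; 6; 7]].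
Definition N5 : 'M[int]_3 := mat3 [:: [:: -1; -4; 4]; [:: 1; -3; 4]; [:: 0; -6; 7]].

Definition genN : 'I_5 -> 'M[int]_3 := tnth [tuple N1; N2; N3; N4; N5].

Definition base_triples : seq 'cV[int]_3 :=
  [:: vec3 5 3 7; vec3 3 5 7; vec3 7 8 13; vec3 8 7 13].

Section OneDimensionalSystem.
Variable R : realType.

Definition preservesQ (A : 'M[R]_3) : Prop :=
  forall v : 'cV[R]_3, Q (A *m v) = Q v.

Definition curveE : set (R * R) := [set p | Q (vec3 p.1 p.2 1) = 0].

Definition FA : set (R * R) := [set p | [/\ curveE p, 0 < p.1 & 0 < p.2]].

(* If [A] is invertible and preserves [Q], the denominator is nonzero on
   [curveE], because [x^2 + x y + y^2 - z^2] has no nonzero zero with [z = 0]. *)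
Definition hat (A : 'M[R]_3) (p : R * R) : R * R :=
  let v := A *m vec3 p.1 p.2 1 in (v 0 0 / v 2 0, v 1 0 / v 2 0).

Definition arcD (k : nat) (N : 'I_k -> 'M[R]_3) (i : 'I_k) : set (R * R) :=
  FA `&` hat (N i) @` FA.

Definition well_defined_system (k : nat) (N : 'I_k -> 'M[R]_3) : Prop :=
  [/\ forall i, preservesQ (N i),
      trivIset setT (arcD N)
    & finite_set (FA `\` \bigcup_i arcD N i)].

(* The value [p] outside every [arcD N i] is a dummy: the system is undefined
   there. *)
Definition corresponding_map (k : nat) (N : 'I_k -> 'M[R]_3)
    (p : R * R) : R * R :=
  if [pick i | `[< arcD N i p >]] is Some i then hat (invmx (N i)) p else p.

Definition genNR (i : 'I_5) : 'M[R]_3 := map_mx intr (genN i).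

Definition pi_map (p : R * R) : R := p.2 / (p.1 + 1).

Definition pi_map_inv (t : R) : R * R :=
  ((1 - t ^+ 2) / (1 + t + t ^+ 2), (t ^+ 2 + 2 * t) / (1 + t + t ^+ 2)).

(* The final value 0 is a dummy, see [T2_dom]. *)
Definition T2 (t : R) : R :=
  if t \in `]0, 1 / 4[ then t / (1 - 3 * t)
  else if t \in `]1 / 4, 1 / 3[ then (1 - 3 * t) / t
  else if t \in `]1 / 3, 2 / 5[ then (3 * t - 1) / (1 - 2 * t)
  else if t \in `]2 / 5, 1 / 2[ then (1 - 2 * t) / (3 * t - 1)
  else if t \in `]1 / 2, 1[ then (2 * t - 1) / t
  else 0.

Definition T2_dom : set R :=
  `]0, 1 / 4[ `|` `]1 / 4, 1 / 3[ `|` `]1 / 3, 2 / 5[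
    `|` `]2 / 5, 1 / 2[ `|` `]1 / 2, 1[.

Definition T2_space : set R := [set t | forall n, T2_dom (iter n T2 t)].

End OneDimensionalSystem.

Arguments FA R : clear implicits.
Arguments genNR R i : clear implicits.
Arguments pi_map R p : clear implicits.
Arguments pi_map_inv R t : clear implicits.
Arguments T2 R t : clear implicits.
Arguments T2_space R : clear implicits.

Definition homeomorphic_by (X Y : topologicalType) (A : set X) (B : set Y)
    (h : X -> Y) (g : Y -> X) : Prop :=
  [/\ h @` A `<=` B /\ g @` B `<=` A,
      (forall x, A x -> g (h x) = x) /\ (forall y, B y -> h (g y) = y),
      {within A, continuous h}
    & {within B, continuous g}].

Definition conjugate_off_finite (X Y : topologicalType) (A : set X) (B : set Y)
    (S : X -> X) (T : Y -> Y) (h : X -> Y) (g : Y -> X) : Prop :=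
  homeomorphic_by A B h g /\
  finite_set (B `&` [set y | T y <> h (S (g y))]).

(* The dynamical notions below concern a map [f] sending the set [X] to itself;
   values of [f] outside [X] play no role. *)
Section Dynamics.
Context (d : measure_display) (T : measurableType d) (R : realType).
Variables (mu : {measure set T -> \bar R}) (X : set T) (f : T -> T).
Local Open Scope ereal_scope.

Definition preim_in (g : T -> T) (A : set T) : set T := X `&` g @^-1` A.

Definition invariant_measure : Prop :=
  measurable_fun X f /\
  forall A, measurable A -> A `<=` X -> mu (preim_in f A) = mu A.

Definition ergodic_measure : Prop :=
  forall A, measurable A -> A `<=` X -> preim_in f A = A ->
    mu A = 0 \/ mu (X `\` A) = 0.

Definition conservative_measure : Prop :=
  ~ exists W : set T,
    [/\ measurable W, W `<=` X, 0 < mu W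
      & trivIset setT (fun n : nat => preim_in (iter n f) W)].

End Dynamics.

Section InvariantMeasure.
Variable R : realType.
Local Open Scope ereal_scope.

Definition density (t : R) : R := (1 / (t * (1 - t)))%R.

Definition mu : set (measurableTypeR R) -> \bar R := fun A =>
  \int[@lebesgue_measure R]_(t in A `&` `]0%R, 1%R[) (density t)%:E.

Let density_ge0 (t : R) : `]0%R, 1%R[%classic t -> 0 <= (density t)%:E.
Proof.
rewrite /= in_itv/= lee_fin => /andP[t0 t1].
by rewrite /density divr_ge0// mulr_ge0// ?subr_ge0 ltW.
Qed.

Let measurable_density : measurable_fun (`]0%R, 1%R[ : set R) (density : R -> R).
Proof.
apply: open_continuous_measurable_fun; first exact: interval_open.
move=> t; rewrite inE/= in_itv/= => /andP[t0 t1].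
apply: cvgM; first exact: cvg_cst.
apply: cvgV; first by rewrite mulf_neq0 ?gt_eqF// subr_gt0.
by apply: cvgM; [exact: cvg_id|apply: cvgB; [exact: cvg_cst|exact: cvg_id]].
Qed.

Let mu0 : mu set0 = 0.
Proof. by rewrite /mu set0I integral_set0. Qed.

Let mu_ge0 A : 0 <= mu A.
Proof. by apply: integral_ge0 => t [_]; exact: density_ge0. Qed.

Let mu_sigma_additive : semi_sigma_additive mu.
Proof.
move=> /= A mA tA mUA; rewrite /mu; apply: cvg_toP.
  apply: ereal_nondecreasing_is_cvgn => m n mn.
  by apply: lee_sum_nneg_natr => // k _ _; exact: mu_ge0.
rewrite setI_bigcupl ge0_integral_bigcup//=.
- by move=> k; apply: measurableI => //; exact: measurable_itv.
- rewrite -setI_bigcupl.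
  apply/measurable_EFinP; apply: measurable_funS measurable_density => //.
- by move=> t [k _ [_]]; exact: density_ge0.
- exact: trivIset_setIr.
Qed.

HB.instance Definition _ :=
  isMeasure.Build _ _ _ mu mu0 mu_ge0 mu_sigma_additive.

End InvariantMeasure.

Arguments mu R : clear implicits.

(* Main.v *)
Require Import Defs.
From mathcomp Require Import all_boot all_order all_algebra.
From mathcomp Require Import all_classical all_reals all_analysis.
From mathcomp Require Import measurable_realfun.
From mathcomp Require Import ring lra zify.

(* On the cone Q = 0 all five inverses share the third row (-6, -6, 7), and the first
   two coordinates of N_3^-1 v = (p, q, r) fall in one of the five open sectors cut
   out by p = 0, q = 0, p + q = 0 other than p, q < 0; the sector determines the last
   letter of the word and 0 < r < v_3 makes the descent terminate at the base
   triples, which are the solutions on the sector boundaries.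
   In the coordinate t the inverse branches of T_2 are Mobius maps of determinant +-1.
   Invariance of mu is checked on intervals, where it says that the odds t / (1 - t) of
   the five preimages of s multiply, with signs, to s / (1 - s).  An inverse branch
   s |-> (a s + b) / (c s + d) of T_2^n has d, c + d >= 1 and c + 2 d >= n + 2, so
   cylinders shrink and distortion is bounded away from 0 and 1.  Every infinite orbit
   visits [1/5, 4/7] infinitely often.  With Borel-Cantelli this gives
   conservativity; with bounded distortion and the Lebesgue density theorem it
   gives ergodicity. *)

Set Implicit Arguments.
Unset Strict Implicit.
Unset Printing Implicit Defensive.

Import Order.TTheory GRing.Theory Num.Theory.
Import numFieldNormedType.Exports.

Local Open Scope classical_set_scope.
Local Open Scope ring_scope.

(** * Coordinates of 3-vectors; the five generators and their integer inverses *)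

Lemma mulmx3E (K : pzRingType) (A : 'M[K]_3) (v : 'cV[K]_3) (i : 'I_3) :
  (A *m v) i 0 = A i 0 * v 0 0 + A i 1 * v 1 0 + A i 2 * v 2 0.
Proof.
rewrite mxE !big_ord_recl big_ord0 addr0 addrA.
by congr (_ * _ + A i _ * v _ 0 + A i _ * v _ 0); apply/val_inj.
Qed.

Lemma vec3E (K : Type) (a b c : K) :
  (vec3 a b c 0 0 = a) * (vec3 a b c 1 0 = b) * (vec3 a b c 2 0 = c).
Proof. by rewrite !mxE. Qed.

Lemma cV3P (K : Type) (u v : 'cV[K]_3) :
  u 0 0 = v 0 0 -> u 1 0 = v 1 0 -> u 2 0 = v 2 0 -> u = v.
Proof.
move=> h0 h1 h2; apply/matrixP => i j; rewrite (ord1 j).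
case: i => [[|[|[|//]]] lti].
- by rewrite (_ : Ordinal lti = 0) //; apply/val_inj.
- by rewrite (_ : Ordinal lti = 1) //; apply/val_inj.
- by rewrite (_ : Ordinal lti = 2) //; apply/val_inj.
Qed.

Lemma ord5P (P : 'I_5 -> Prop) :
  P 0 -> P 1 -> P 2 -> P 3 -> P 4 -> forall i, P i.
Proof.
move=> p0 p1 p2 p3 p4 [[|[|[|[|[|//]]]]] lti];
by match goal with |- P ?i => (rewrite (_ : i = 0) //; last exact/val_inj) ||
  (rewrite (_ : i = 1) //; last exact/val_inj) ||
  (rewrite (_ : i = 2) //; last exact/val_inj) ||
  (rewrite (_ : i = 3) //; last exact/val_inj) ||
  (rewrite (_ : i = 4) //; last exact/val_inj) end.
Qed.

Lemma genNE : (genN 0 = N1) * (genN 1 = N2) * (genN 2 = N3) * (genN 3 = N4) * (genN 4 = N5).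
Proof. by []. Qed.

(** The triple (p, q, r) is [N3]^-1 v, and every entry of the tuple is an automorphism of the form
    x^2 + x y + y^2 applied to (p, q). So asking which inverse keeps v positive is asking in which
    sector (p, q) lies. *)
Definition invN (i : 'I_5) (v : 'cV[int]_3) : 'cV[int]_3 :=
  let p := 4 * v 0 0 + 3 * v 1 0 - 4 * v 2 0 in
  let q := 3 * v 0 0 + 4 * v 1 0 - 4 * v 2 0 in
  let r := 7 * v 2 0 - 6 * v 0 0 - 6 * v 1 0 in
  let xy := tnth [tuple (- p - q, p); (p + q, - q); (p, q); (- p, p + q); (q, - p - q)] i
  in vec3 xy.1 xy.2 r.

Lemma N1E (v : 'cV[int]_3) : N1 *m v = vec3 (- 3 * v 0 0 + v 1 0 + 4 * v 2 0)
  (- 4 * v 0 0 - v 1 0 + 4 * v 2 0) (- 6 * v 0 0 + 7 * v 2 0).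
Proof. by apply: cV3P; rewrite mulmx3E vec3E /N1 !mxE /=; ring. Qed.
Lemma N2E (v : 'cV[int]_3) : N2 *m v = vec3 (4 * v 0 0 + v 1 0 + 4 * v 2 0)
  (3 * v 0 0 - v 1 0 + 4 * v 2 0) (6 * v 0 0 + 7 * v 2 0).
Proof. by apply: cV3P; rewrite mulmx3E vec3E !mxE /=; ring. Qed.
Lemma N3E (v : 'cV[int]_3) : N3 *m v = vec3 (4 * v 0 0 + 3 * v 1 0 + 4 * v 2 0)
  (3 * v 0 0 + 4 * v 1 0 + 4 * v 2 0) (6 * v 0 0 + 6 * v 1 0 + 7 * v 2 0).
Proof. by apply: cV3P; rewrite mulmx3E vec3E !mxE /=; ring. Qed.
Lemma N4E (v : 'cV[int]_3) : N4 *m v = vec3 (- v 0 0 + 3 * v 1 0 + 4 * v 2 0)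
  (v 0 0 + 4 * v 1 0 + 4 * v 2 0) (6 * v 1 0 + 7 * v 2 0).
Proof. by apply: cV3P; rewrite mulmx3E vec3E !mxE /=; ring. Qed.
Lemma N5E (v : 'cV[int]_3) : N5 *m v = vec3 (- v 0 0 - 4 * v 1 0 + 4 * v 2 0)
  (v 0 0 - 3 * v 1 0 + 4 * v 2 0) (- 6 * v 1 0 + 7 * v 2 0).
Proof. by apply: cV3P; rewrite mulmx3E vec3E !mxE /=; ring. Qed.
Definition NE := (N1E, N2E, N3E, N4E, N5E).

Lemma genNK i : cancel (mulmx (genN i)) (invN i).
Proof.
by move=> v; elim/ord5P: i; rewrite genNE NE /invN /= !vec3E; apply: cV3P; rewrite !vec3E; ring.
Qed.

Lemma invNK i : cancel (invN i) (mulmx (genN i)).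
Proof.
by move=> v; elim/ord5P: i; rewrite genNE NE /invN /= !vec3E; apply: cV3P; rewrite !vec3E; ring.
Qed.

Lemma Q_genN i v : Q (genN i *m v) = Q v.
Proof.
by elim/ord5P: i; rewrite genNE NE /Q !vec3E; ring.
Qed.

Lemma primitive_of_dvd (u v : 'cV[int]_3) :
  (forall d : int, (forall i, (d %| u i 0%R)%Z) -> forall i, (d %| v i 0%R)%Z) ->
  primitive v -> primitive u.
Proof. by move=> uv pv d d1 du; apply: (pv d d1); exact: uv. Qed.

Lemma dvdz_vec3 (d a b c : int) :
  (forall i, (d %| vec3 a b c i 0%R)%Z) <-> [/\ (d %| a)%Z, (d %| b)%Z & (d %| c)%Z].
Proof.
split=> [h|[ha hb hc] [[|[|[|//]]] lti]]; try by rewrite mxE.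
have [[h0 h1] h2] := (h 0, h 1, h 2).
by rewrite !vec3E in h0 h1 h2.
Qed.

(** Both [genN i] and its inverse have integer entries, so common divisors of the coordinates pass
    in either direction. *)
Lemma primitive_genN i u : primitive (genN i *m u) <-> primitive u.
Proof.
split; apply: primitive_of_dvd => d h.
  by move=> j; rewrite mulmx3E !rpredD // dvdz_mull.
have [[h0 h1] h2] := (h 0, h 1, h 2).
rewrite -(genNK i u); move: (genN i *m u) h0 h1 h2 {h} => v h0 h1 h2.
by elim/ord5P: i; rewrite /invN /=; apply/dvdz_vec3; split;
  rewrite ?(rpredB, rpredN, rpredD) ?dvdz_mull.
Qed.

Lemma primitive_solution_genN i u :
  primitive_solution F u -> primitive_solution F (genN i *m u).
Proof.
case=> -[u0 u1 u2] Qu pu; split; [|by rewrite Q_genN|exact/primitive_genN].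
move: Qu; rewrite /Q => Qu.
move: (u 0 0) (u 1 0) (u 2 0) u0 u1 u2 Qu (N1E u) (N2E u) (N3E u) (N4E u) (N5E u).
move=> x y z x0 y0 z0 Qxyz e1 e2 e3 e4 e5; rewrite /F /=.
(* Some entries of the matrices are negative. The bounds come from the cone equation by comparing
   squares, for instance 16 z^2 - (x + 4 y)^2 = 15 x^2 + 8 x y > 0, and suffice for positivity in
   all five cases. *)
have xz : x < z by nia.
have yz : y < z by nia.
have xyz : x + 4 * y < 4 * z by nia.
have yxz : 4 * x + y < 4 * z by nia.
elim/ord5P: i; rewrite genNE ?e1 ?e2 ?e3 ?e4 ?e5 !vec3E; split; lia.
Qed.

Lemma base_triples_primitive b :
  b \in base_triples -> primitive_solution F b.
Proof.
move=> bb.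
suff : [\/ b = vec3 5 3 7, b = vec3 3 5 7, b = vec3 7 8 13 | b = vec3 8 7 13].
  move=> h; split.
  - by case: h => ->; rewrite /F /= !vec3E.
  - by case: h => ->; rewrite /Q /= !vec3E.
  - move=> d d1 db; have : (d %| 1)%Z; last by rewrite dvdz1; lia.
    case: h db => -> /dvdz_vec3[h1 h2 _].
    + by rewrite (_ : 1%Z = 2 * 5 - 3 * 3) // rpredB // dvdz_mull.
    + by rewrite (_ : 1%Z = 2 * 5 - 3 * 3) // rpredB // dvdz_mull.
    + by rewrite (_ : 1%Z = 8 - 7) // rpredB.
    + by rewrite (_ : 1%Z = 8 - 7) // rpredB.
move: bb; rewrite !inE => /or4P[] /eqP ->.
- exact: Or41.
- exact: Or42.
- exact: Or43.
- exact: Or44.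
Qed.

(** For a base triple one of p, q, p + q vanishes, so no inverse sends it to a triple with positive
    coordinates. *)
Lemma genN_neq_base i u : F u -> genN i *m u \notin base_triples.
Proof.
case=> u0 u1 u2; apply/negP => bb; have := genNK i u.
move: bb; rewrite !inE => /or4P[] /eqP ->;
by elim/ord5P: i; rewrite /invN /= !vec3E => e; move: u0 u1 u2; rewrite -e !vec3E.
Qed.

(** Positivity of the [i]-th preimage places (p, q) in the [i]-th open sector, and these sectors are
    disjoint. *)
Lemma genN_disjoint i j u v : F u -> F v -> genN i *m u = genN j *m v -> i = j.
Proof.
case=> u0 u1 u2 [v0 v1 v2] e.
have := genNK i u; have := genNK j v; rewrite e.
move: (genN j *m v) => w ev eu; move: u0 u1 v0 v1.
rewrite -eu -ev /invN; elim/ord5P: i {e eu}; elim/ord5P: j {ev} => //=; rewrite !vec3E => *; lia.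
Qed.

(** * Descent of primitive solutions to the base triples *)

Lemma height_bounds (a b c : int) : 0 < a -> 0 < b -> 0 < c ->
  a ^+ 2 + a * b + b ^+ 2 - c ^+ 2 = 0 -> (c < a + b) && (6 * a + 6 * b < 7 * c).
Proof.
move=> a0 b0 c0 e; apply/andP; split; first nia.
(* On the cone, 49 c^2 - 36 (a + b)^2 = 13 (a - b)^2 + 3 a b, which is positive. *)
have ab0 : 0 < a * b by nia.
have sq : 0 <= (a - b) ^+ 2 by rewrite sqr_ge0.
rewrite ltNge; apply/negP => h.
have : (7 * c) * (7 * c) <= (6 * a + 6 * b) * (6 * a + 6 * b) by rewrite ler_pM//; lia.
nia.
Qed.

Lemma primitive_height1 v : primitive v -> (forall i, (v 2%R 0%R %| v i 0%R)%Z) -> v 2 0 <= 1.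
Proof. by move=> pv dv; rewrite leNgt; apply/negP => h; apply: (pv _ h). Qed.

Lemma vec3_eta (K : Type) (v : 'cV[K]_3) : v = vec3 (v 0 0) (v 1 0) (v 2 0).
Proof. by apply: cV3P; rewrite vec3E. Qed.

Lemma invN_vec3 i a b c :
  let p := 4 * a + 3 * b - 4 * c in
  let q := 3 * a + 4 * b - 4 * c in
  let r := 7 * c - 6 * a - 6 * b in
  let xy := tnth [tuple (- p - q, p); (p + q, - q); (p, q); (- p, p + q); (q, - p - q)] i
  in invN i (vec3 a b c) = vec3 xy.1 xy.2 r.
Proof. by rewrite /invN /= !vec3E. Qed.

(** On each of the three boundary lines the quadratic form reduces to a single square, which leaves
    two signs per line. *)
Lemma boundary_cases (p q r : int) : p ^+ 2 + p * q + q ^+ 2 - r ^+ 2 = 0 ->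
  [|| p == 0, q == 0 | p + q == 0] ->
  [\/ p = 0 /\ q = r, p = 0 /\ q = - r, p = r /\ q = 0 | p = - r /\ q = 0] \/
  (p = r /\ q = - r) \/ (p = - r /\ q = r).
Proof.
move=> e /or3P[] /eqP h.
- have /eqP : q ^+ 2 = r ^+ 2 by move: e; rewrite h; lia.
  by rewrite eqf_sqr => /orP[] /eqP ->; left; [apply: Or41|apply: Or42].
- have /eqP : p ^+ 2 = r ^+ 2 by move: e; rewrite h; lia.
  by rewrite eqf_sqr => /orP[] /eqP ->; left; [apply: Or43|apply: Or44].
- have qp : q = - p by lia.
  have /eqP : p ^+ 2 = r ^+ 2 by move: e; rewrite qp; lia.
  by rewrite qp eqf_sqr => /orP[] /eqP ->; right; [left|right]; rewrite ?opprK.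
Qed.

(** This excludes the one sector that belongs to no generator. Squaring q < 0 against 16 c^2 gives 8
    b < 7 a, squaring p < 0 gives 8 a < 7 b, and these are incompatible for positive a, b. *)
Lemma sector_nonempty (a b c : int) : 0 < a -> 0 < b -> 0 < c ->
  a ^+ 2 + a * b + b ^+ 2 - c ^+ 2 = 0 ->
  (0 <= 4 * a + 3 * b - 4 * c) || (0 <= 3 * a + 4 * b - 4 * c).
Proof.
move=> a0 b0 c0 e.
have sq (x y : int) : 0 < x -> x < y -> x * x < y * y by nia.
apply/negPn; rewrite negb_or -!ltNge; apply/negP => /andP[p0 q0].
have l1 : 8 * b < 7 * a.
  have h : (3 * a + 4 * b) * (3 * a + 4 * b) < 4 * c * (4 * c) by apply: sq; lia.
  by rewrite -(ltr_pM2l a0); clear -h e; lia.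
have l2 : 8 * a < 7 * b.
  have h : (4 * a + 3 * b) * (4 * a + 3 * b) < 4 * c * (4 * c) by apply: sq; lia.
  by rewrite -(ltr_pM2l b0); clear -h e; lia.
lia.
Qed.

Lemma primitive_descent v : primitive_solution F v -> v \notin base_triples ->
  exists i u, [/\ primitive_solution F u, v = genN i *m u & u 2 0 < v 2 0].
Proof.
rewrite (vec3_eta v); move: (v 0 0) (v 1 0) (v 2 0) => a b c {v}.
rewrite {1 2}/primitive_solution /=.
case=> + Qv pv vb; rewrite {1}/F /= !vec3E => -[a0 b0 c0].
have Qabc : a ^+ 2 + a * b + b ^+ 2 - c ^+ 2 = 0 by move: Qv; rewrite /Q !vec3E.
have /andP[cab abc] := height_bounds a0 b0 c0 Qabc.
set p := 4 * a + 3 * b - 4 * c.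
set q := 3 * a + 4 * b - 4 * c.
set r := 7 * c - 6 * a - 6 * b.
have r0 : 0 < r by rewrite /r; lia.
have rc : r < c by rewrite /r; lia.
(* Since 0 < r < c for the common third coordinate r, an inverse with positive first two coordinates
   already yields a smaller solution. *)
have h i x y : invN i (vec3 a b c) = vec3 x y r -> 0 < x -> 0 < y ->
    exists i u, [/\ primitive_solution F u, vec3 a b c = genN i *m u & u 2 0 < c].
  move=> e x0 y0; exists i, (vec3 x y r).
  rewrite -e; split; [split| by rewrite invNK|by rewrite e vec3E].
  - by rewrite e; split; rewrite ?vec3E.
  - by rewrite -Qv -(Q_genN i) invNK.
  - by rewrite -(primitive_genN i) invNK.
have := (h 0 _ _ (invN_vec3 0 a b c), h 1 _ _ (invN_vec3 1 a b c),
  h 2 _ _ (invN_vec3 2 a b c), h 3 _ _ (invN_vec3 3 a b c),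
  h 4 _ _ (invN_vec3 4 a b c)).
rewrite /= -/p -/q {h} => -[[[[h0 h1] h2] h3] h4].
have pq : (0 <= p) || (0 <= q) := sector_nonempty a0 b0 c0 Qabc.
have [hp|pq0] := boolP [|| p == 0, q == 0 | p + q == 0]; last first.
  have [p0|p0] := ltP 0 p; have [q0|q0] := ltP 0 q.
  - exact: h2.
  - have [pq'|pq'] := ltP 0 (p + q); [apply: h1|apply: h0]; lia.
  - have [pq'|pq'] := ltP 0 (p + q); [apply: h3|apply: h4]; lia.
  - lia.
have invE : invN 2 (vec3 a b c) = vec3 p q r by rewrite invN_vec3.
have Qpqr : p ^+ 2 + p * q + q ^+ 2 - r ^+ 2 = 0.
  have <- : Q (invN 2 (vec3 a b c)) = 0 by rewrite -Qv -(Q_genN 2) invNK.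
  by rewrite invE /Q !vec3E.
have := boundary_cases Qpqr hp => {}hp.
(* On a boundary line p and q lie in {0, r, -r}, so r divides all coordinates of a primitive
   triple. *)
have r1 : r = 1.
  suff : r <= 1 by lia.
  have := @primitive_height1 (invN 2 (vec3 a b c)); rewrite invE vec3E; apply.
    by rewrite -invE -(primitive_genN 2) invNK.
  apply/dvdz_vec3.
  by case: hp => [[]|[]] -[-> ->]; rewrite ?dvdz0 ?rpredN.
exfalso; move/negP: vb; apply; rewrite !inE.
have e0 : a = 4 * p + 3 * q + 4 * r by rewrite /p /q /r; ring.
have e1 : b = 3 * p + 4 * q + 4 * r by rewrite /p /q /r; ring.
have e2 : c = 6 * p + 6 * q + 7 * r by rewrite /p /q /r; ring.
(* Of the six boundary points with r = 1, the point (0, -1) gives b = 0 and (-1, 0) gives a = 0; the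
   other four are the base triples. *)
have {}hp : [\/ (p = 0 /\ q = 1), (p = 1 /\ q = 0), (p = 1 /\ q = -1) | (p = -1 /\ q = 1)].
  move: hp e0 e1 e2 a0 b0; rewrite r1; clear.
  move: p q => p q hp e0 e1 e2 a0 b0.
  case: hp => [[]|[]] -[hp hq]; rewrite hp hq in e0 e1.
  - by apply: Or41.
  - by exfalso; lia.
  - by apply: Or42.
  - by exfalso; lia.
  - by apply: Or43.
  - by apply: Or44.
by case: hp => -[hp hq]; rewrite e0 e1 e2 hp hq r1 eqxx ?orbT.
Qed.

(** * Existence and uniqueness of the word of a primitive solution *)

Lemma word_vec_primitive w b : b \in base_triples ->
  primitive_solution F (word_vec genN w b).
Proof.
move=> bb; rewrite /word_vec; elim: w => [|i w ih].
  by rewrite big_nil mul1mx; exact: base_triples_primitive.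
by rewrite big_cons -mulmxA; exact: primitive_solution_genN.
Qed.

(** The outermost matrix is determined by [genN_disjoint] and can be cancelled; a base triple is
    never an image, so both words end together. *)
Lemma word_vec_inj w1 w2 b1 b2 : b1 \in base_triples -> b2 \in base_triples ->
  word_vec genN w1 b1 = word_vec genN w2 b2 -> (w1, b1) = (w2, b2).
Proof.
move=> bb1 bb2; elim: w1 w2 => [|i w1 ih] [|j w2].
- by rewrite /word_vec !big_nil !mul1mx => ->.
- rewrite {1}/word_vec big_nil mul1mx {1}/word_vec big_cons -mulmxA => e.
  move: bb1; rewrite e (negbTE (genN_neq_base _ _)) //.
  by have [] := word_vec_primitive w2 bb2.
- rewrite {2}/word_vec big_nil mul1mx {1}/word_vec big_cons -mulmxA => e.
  move: bb2; rewrite -e (negbTE (genN_neq_base _ _)) //.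
  by have [] := word_vec_primitive w1 bb1.
- rewrite /word_vec !big_cons -!mulmxA -!/(word_vec _ _ _) => e.
  have [F1 _ _] := word_vec_primitive w1 bb1.
  have [F2 _ _] := word_vec_primitive w2 bb2.
  have ij := genN_disjoint F1 F2 e; move: e; rewrite ij => /(can_inj (genNK j)) /ih [-> ->].
  by [].
Qed.

Lemma genN_generating : matrix_generating_system genN base_triples F.
Proof.
split=> [w b|v]; first exact: word_vec_primitive.
move=> vF.
have [[w b] /= [bb wbv]] : exists wb : seq 'I_5 * 'cV[int]_3,
    wb.2 \in base_triples /\ word_vec genN wb.1 wb.2 = v.
  (* The descent becomes an induction on a bound for the third coordinate. *)
  have [n vn] : exists n : nat, v 2 0 <= n%:Z by exists `|v 2%R 0%R|%N; lia.
  elim: n v vn vF => [|n ih] v vn vF.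
    by case: vF => -[_ _]; rewrite ltNge vn.
  have [vb|vb] := boolP (v \in base_triples).
    by exists ([::], v); rewrite /word_vec big_nil mul1mx.
  have [i [u [uF vE uv]]] := primitive_descent vF vb.
  have [|[w b] /= [bb wbu]] := ih u _ uF.
    by rewrite -ltzD1; apply: lt_le_trans uv (le_trans vn _); lia.
  by exists (i :: w, b); split=> //; rewrite vE -wbu /word_vec big_cons mulmxA.
exists (w, b); split=> // -[w' b'] /= [bb' w'b'v].
by apply: word_vec_inj => //; rewrite wbv.
Qed.

Ltac nonzero := repeat (apply/andP; split); apply/eqP => ?; lra.

(** * The inverse branches of T_2 *)

Section Arcs.
Variable R : realType.
Implicit Types (s t : R) (p q : R * R).

Lemma ltr_frac (a b x y : R) : 0 < y -> a * y < x -> x < b * y ->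
  (a < x / y) && (x / y < b).
Proof. by move=> y0 h1 h2; rewrite ltr_pdivlMr // ltr_pdivrMr // h1. Qed.

Definition sel5 (a b c d e : R) (i : 'I_5) : R := nth 0 [:: a; b; c; d; e] i.

Lemma sel5E a b c d e : (sel5 a b c d e 0 = a) * (sel5 a b c d e 1 = b) *
  (sel5 a b c d e 2 = c) * (sel5 a b c d e 3 = d) * (sel5 a b c d e 4 = e).
Proof. by []. Qed.

(** The inverse of the [i]-th piece of [T2]. It is also the action of [genNR i] read in the
    coordinate t, as [hat_genNR] shows. *)
Definition branch (i : 'I_5) s : R := sel5 (s / (1 + 3 * s)) (1 / (s + 3))
  ((1 + s) / (3 + 2 * s)) ((1 + s) / (2 + 3 * s)) (1 / (2 - s)) i.

Definition branch_lo (i : 'I_5) : R := sel5 (0) (1 / 4) (1 / 3) (2 / 5) (1 / 2) i.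
Definition branch_hi (i : 'I_5) : R := sel5 (1 / 4) (1 / 3) (2 / 5) (1 / 2) (1) i.

Lemma branch_itv i s : 0 < s -> s < 1 ->
  (branch_lo i < branch i s) && (branch i s < branch_hi i).
Proof.
move=> s0 s1; elim/ord5P: i; rewrite /branch /branch_lo /branch_hi !sel5E /=.
all: by apply: ltr_frac; lra.
Qed.

Lemma branch01 i s : 0 < s -> s < 1 -> (0 < branch i s) && (branch i s < 1).
Proof.
move=> s0 s1; have /andP[h1 h2] := branch_itv i s0 s1; apply/andP; move: h1 h2.
by elim/ord5P: i; rewrite /branch_lo /branch_hi ?sel5E /= => h1 h2; split; lra.
Qed.

Lemma branch_disjoint i j s t : 0 < s -> s < 1 -> 0 < t -> t < 1 ->
  branch i s = branch j t -> i = j.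
Proof.
move=> s0 s1 t0 t1 e; have := branch_itv i s0 s1; have := branch_itv j t0 t1.
rewrite e; move: (branch j t) => x.
elim/ord5P: i {e}; elim/ord5P: j; rewrite /branch_lo /branch_hi ?sel5E //=
  => /andP[h1 h2] /andP[h3 h4]; exfalso; lra.
Qed.

Lemma T2E i t : branch_lo i < t -> t < branch_hi i ->
  T2 R t = sel5 (t / (1 - 3 * t)) ((1 - 3 * t) / t)
    ((3 * t - 1) / (1 - 2 * t)) ((1 - 2 * t) / (3 * t - 1)) ((2 * t - 1) / t) i.
Proof.
rewrite /T2 !in_itv /=; elim/ord5P: i; rewrite /branch_lo /branch_hi ?sel5E /= => h1 h2.
all: do ![case: ifPn => [?|]]; rewrite ?h1 ?h2 //=; lra.
Qed.

Lemma T2_branch i s : 0 < s -> s < 1 -> T2 R (branch i s) = s.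
Proof.
move=> s0 s1; have /andP[h1 h2] := branch_itv i s0 s1; rewrite (T2E h1 h2) /branch.
elim/ord5P: i {h1 h2}; rewrite ?sel5E; field; nonzero.
Qed.

Lemma T2_domE t : T2_dom t <-> exists i, branch_lo i < t /\ t < branch_hi i.
Proof.
rewrite /T2_dom /setU /= !in_itv /=; split.
  case=> [[[[]|]|]|] /andP[h1 h2]; [exists 0|exists 1|exists 2|exists 3|exists 4];
    by rewrite /branch_lo /branch_hi ?sel5E /=.
case; elim/ord5P; rewrite /branch_lo /branch_hi ?sel5E /= => -[h1 h2].
all: have h := conj h1 h2; move/andP: h => {h1 h2}; tauto.
Qed.

Lemma T2_off_dom t : ~ T2_dom t -> T2 R t = 0.
Proof.
rewrite /T2_dom /setU /= => tD.
by rewrite /T2; do 5! [case: ifPn => [h|_]; first by exfalso; apply: tD; tauto].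
Qed.

Lemma branch_T2 i t : branch_lo i < t -> t < branch_hi i ->
  [/\ 0 < T2 R t, T2 R t < 1 & branch i (T2 R t) = t].
Proof.
move=> h1 h2; rewrite (T2E h1 h2); move: h1 h2.
elim/ord5P: i; rewrite /branch /branch_lo /branch_hi !sel5E /= => h1 h2.
all: split; [apply: divr_gt0; lra | rewrite ltr_pdivrMr; lra | field; nonzero].
Qed.

Lemma T2_domP t : T2_dom t <-> exists i s, [/\ 0 < s, s < 1 & t = branch i s].
Proof.
rewrite T2_domE; split=> [[i [h1 h2]]|[i [s [s0 s1 ->]]]].
  by have [h3 h4 h5] := branch_T2 h1 h2; exists i, (T2 R t).
by exists i; apply/andP/branch_itv.
Qed.

End Arcs.

(** * The arc system and its conjugacy with T_2 *)

Section Conjugacy.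
Variable R : realType.
Implicit Types (s t : R) (p q : R * R).

Lemma genNRE i v : genNR R i *m v =
  vec3 (sel5 (- 3 * v 0 0 + v 1 0 + 4 * v 2 0) (4 * v 0 0 + v 1 0 + 4 * v 2 0)
         (4 * v 0 0 + 3 * v 1 0 + 4 * v 2 0) (- v 0 0 + 3 * v 1 0 + 4 * v 2 0)
         (- v 0 0 - 4 * v 1 0 + 4 * v 2 0) i)
       (sel5 (- 4 * v 0 0 - v 1 0 + 4 * v 2 0) (3 * v 0 0 - v 1 0 + 4 * v 2 0)
         (3 * v 0 0 + 4 * v 1 0 + 4 * v 2 0) (v 0 0 + 4 * v 1 0 + 4 * v 2 0)
         (v 0 0 - 3 * v 1 0 + 4 * v 2 0) i)
       (sel5 (- 6 * v 0 0 + 7 * v 2 0) (6 * v 0 0 + 7 * v 2 0)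
         (6 * v 0 0 + 6 * v 1 0 + 7 * v 2 0) (6 * v 1 0 + 7 * v 2 0)
         (- 6 * v 1 0 + 7 * v 2 0) i).
Proof.
apply: cV3P; rewrite mulmx3E vec3E; elim/ord5P: i; rewrite sel5E /genNR genNE !mxE /=; ring.
Qed.

Lemma preservesQ_genNR i : preservesQ (genNR R i).
Proof.
by move=> v; rewrite genNRE /Q !vec3E; elim/ord5P: i; rewrite !sel5E; ring.
Qed.

Lemma genNR_unit i : genNR R i \in unitmx.
Proof.
(* The integer inverse has as columns the values of [invN i] on the standard basis. *)
suff : genN i *m (\matrix_(r < 3, c < 3) invN i (delta_mx c 0) r 0) = 1%:M.
  by move=> /(congr1 (map_mx (intr : int -> R))); rewrite map_mxM map_mx1 => /mulmx1_unit[].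
apply/matrixP => r c.
have := congr1 (fun v : 'cV[int]_3 => v r 0) (invNK i (delta_mx c 0)).
rewrite !mxE /= andbT => <-; apply: eq_bigr => k _; by rewrite mxE.
Qed.

Lemma quad_gt0 t : 0 < 1 + t + t ^+ 2.
Proof. by have := sqr_ge0 (t + 1 / 2); lra. Qed.

Lemma pi_mapK t : 0 < t -> t < 1 -> pi_map R (pi_map_inv R t) = t.
Proof.
move=> t0 t1; rewrite /pi_map /pi_map_inv /=; field.
have := quad_gt0 t => q0.
apply/andP; split; apply/eqP => ?; nra.
Qed.

Lemma FA_pi_map_inv t : 0 < t -> t < 1 -> FA R (pi_map_inv R t).
Proof.
move=> t0 t1; have q0 := quad_gt0 t; split => /=.
- rewrite /curveE /= /Q !vec3E; field; exact: lt0r_neq0.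
- by apply: divr_gt0 => //; nra.
- by apply: divr_gt0 => //; nra.
Qed.

Lemma pi_map_FA p : FA R p -> 0 < pi_map R p /\ pi_map R p < 1.
Proof.
case: p => x y [/= + x0 y0]; rewrite /curveE /= /Q !vec3E => e.
have h : 0 < x + 1 by lra.
rewrite /pi_map /=; split; first by rewrite divr_gt0.
rewrite ltr_pdivrMr // mul1r; nra.
Qed.

(** The slope of the line from p to the point (-1, 0) of the conic is [pi_map p], and [pi_map_inv]
    returns the second intersection. Both simplifications below hold modulo the conic equation
    [e]. *)
Lemma pi_map_invK p : FA R p -> pi_map_inv R (pi_map R p) = p.
Proof.
case: p => x y [/= + x0 y0]; rewrite /curveE /= /Q !vec3E => e.
have h : x + 1 != 0 by apply: lt0r_neq0; lra.
have hA : 2 + 2 * x + y != 0 by apply: lt0r_neq0; lra.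
rewrite /pi_map_inv /pi_map /=.
have -> : 1 + y / (x + 1) + (y / (x + 1)) ^+ 2 = (2 + 2 * x + y) / (x + 1) ^+ 2.
  apply/eqP; rewrite -subr_eq0; apply/eqP.
  transitivity ((x ^+ 2 + x * y + y ^+ 2 - 1 ^+ 2) / (x + 1) ^+ 2); last by rewrite e mul0r.
  by field.
have -> : 1 - (y / (x + 1)) ^+ 2 = x * (2 + 2 * x + y) / (x + 1) ^+ 2.
  apply/eqP; rewrite -subr_eq0; apply/eqP.
  transitivity (- (x ^+ 2 + x * y + y ^+ 2 - 1 ^+ 2) / (x + 1) ^+ 2); last by rewrite e oppr0 mul0r.
  by field.
congr (_, _); field; by rewrite hA h.
Qed.

Lemma genNR_denom_gt0 i t : 0 < t -> t < 1 ->
  0 < (genNR R i *m vec3 (pi_map_inv R t).1 (pi_map_inv R t).2 1) 2 0.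
Proof.
move=> t0 t1; rewrite genNRE !vec3E /pi_map_inv /=.
have q0 := quad_gt0 t.
(* These quadratics are the third coordinates after multiplication by 1 + t + t^2. *)
suff : 0 < sel5 (1 + 7 * t + 13 * t ^+ 2) (13 + 7 * t + t ^+ 2) (13 + 19 * t + 7 * t ^+ 2)
   (7 + 19 * t + 13 * t ^+ 2) (7 - 5 * t + t ^+ 2) i / (1 + t + t ^+ 2).
  move=> h; apply: (lt_le_trans h); rewrite le_eqVlt; apply/orP; left; apply/eqP.
  by elim/ord5P: i {h}; rewrite !sel5E; field; exact: lt0r_neq0.
by apply: divr_gt0 => //; elim/ord5P: i; rewrite sel5E; nra.
Qed.

Lemma hat_genNR i t : 0 < t -> t < 1 ->
  hat (genNR R i) (pi_map_inv R t) = pi_map_inv R (branch i t).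
Proof.
move=> t0 t1; have := genNR_denom_gt0 i t0 t1; have /andP[b0 b1] := branch01 i t0 t1.
have q0 := quad_gt0 t; have := quad_gt0 (branch i t).
rewrite /hat genNRE !vec3E /pi_map_inv /branch /=.
elim/ord5P: i {b0 b1}; rewrite !sel5E => h1 h2; congr (_, _).
all: field; repeat (apply/andP; split); apply/eqP => h; nra.
Qed.

(** The map [hat] is a projective action: normalising the last coordinate to 1 rescales the vector,
    and the final division cancels the scalar. *)
Lemma hat_invmx (A : 'M[R]_3) p : A \in unitmx ->
  (A *m vec3 p.1 p.2 1) 2 0 != 0 -> hat (invmx A) (hat A p) = p.
Proof.
move=> Au v20; rewrite {1}/hat.
have -> : vec3 (hat A p).1 (hat A p).2 1 =
    ((A *m vec3 p.1 p.2 1) 2 0)^-1 *: (A *m vec3 p.1 p.2 1).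
  rewrite /hat; move: (A *m _) v20 => v v20.
  by apply: cV3P; rewrite !vec3E [RHS]mxE; [exact: mulrC|exact: mulrC|rewrite mulVf].
rewrite -scalemxAr mulKmx // [in RHS](surjective_pairing p).
move: ((A *m _) 2 0) v20 => c c0.
by congr (_, _); rewrite [X in X / _]mxE [X in _ / X]mxE !vec3E; field.
Qed.

Lemma hat_invmx_genNR i t : 0 < t -> t < 1 ->
  hat (invmx (genNR R i)) (pi_map_inv R (branch i t)) = pi_map_inv R t.
Proof.
move=> t0 t1; rewrite -hat_genNR // hat_invmx ?genNR_unit //.
exact/lt0r_neq0/genNR_denom_gt0.
Qed.

Lemma arcDP i p : arcD (genNR R) i p <->
  exists t, [/\ 0 < t, t < 1 & p = pi_map_inv R (branch i t)].
Proof.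
split=> [[_ [q Fq <-]]|[t [t0 t1 ->]]].
  have [t0 t1] := pi_map_FA Fq; exists (pi_map R q); split=> //.
  by rewrite -hat_genNR // pi_map_invK.
have /andP[b0 b1] := branch01 i t0 t1.
split; first exact: FA_pi_map_inv.
by exists (pi_map_inv R t); [exact: FA_pi_map_inv|exact: hat_genNR].
Qed.

Lemma arcD_disjoint i j p : arcD (genNR R) i p -> arcD (genNR R) j p -> i = j.
Proof.
move=> /arcDP[s [s0 s1 ->]] /arcDP[t [t0 t1]].
move=> /(congr1 (pi_map R)).
have /andP[? ?] := branch01 i s0 s1; have /andP[? ?] := branch01 j t0 t1.
rewrite !pi_mapK //; exact: branch_disjoint.
Qed.

Lemma outside_T2_dom t : 0 < t -> t < 1 -> ~ T2_dom t ->
  t \in [:: 1 / 4; 1 / 3; 2 / 5; 1 / 2].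
Proof.
move=> t0 t1 /T2_domE tD; rewrite !inE; apply/negPn/negP; rewrite !negb_or.
move=> /and4P[n1 n2 n3 n4]; apply: tD.
have [h1|h1] := ltP t (1 / 4); first by exists 0; rewrite /branch_lo /branch_hi !sel5E.
have {}h1 : 1 / 4 < t by rewrite lt_neqAle eq_sym n1.
have [h2|h2] := ltP t (1 / 3); first by exists 1; rewrite /branch_lo /branch_hi !sel5E.
have {}h2 : 1 / 3 < t by rewrite lt_neqAle eq_sym n2.
have [h3|h3] := ltP t (2 / 5); first by exists 2; rewrite /branch_lo /branch_hi !sel5E.
have {}h3 : 2 / 5 < t by rewrite lt_neqAle eq_sym n3.
have [h4|h4] := ltP t (1 / 2); first by exists 3; rewrite /branch_lo /branch_hi !sel5E.
have {}h4 : 1 / 2 < t by rewrite lt_neqAle eq_sym n4.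
by exists 4; rewrite /branch_lo /branch_hi !sel5E.
Qed.

Lemma genNR_system : well_defined_system (genNR R).
Proof.
split.
- exact: preservesQ_genNR.
- by move=> i j _ _ [p [pi pj]]; exact: arcD_disjoint pi pj.
- apply: (@sub_finite_set _ _ 
      [set` [seq pi_map_inv R t | t <- [:: 1 / 4; 1 / 3; 2 / 5; 1 / 2 : R]]]);
    last exact: finite_seq.
  move=> p [Fp np]; have [t0 t1] := pi_map_FA Fp.
  rewrite -(pi_map_invK Fp); apply: map_f; apply: outside_T2_dom => //.
  move=> /T2_domP[i [s [s0 s1 e]]]; apply: np; exists i => //.
  by apply/arcDP; exists s; split => //; rewrite -e pi_map_invK.
Qed.

Lemma corresponding_map_branch i t : 0 < t -> t < 1 ->
  corresponding_map (genNR R) (pi_map_inv R (branch i t)) = pi_map_inv R t.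
Proof.
move=> t0 t1.
have Di : arcD (genNR R) i (pi_map_inv R (branch i t)) by apply/arcDP; exists t.
rewrite /corresponding_map; case: pickP => [j /asboolP Dj|/(_ i)]; last first.
  by move/asboolP.
by rewrite (arcD_disjoint Dj Di) hat_invmx_genNR.
Qed.

Lemma continuous_pi_map : {within FA R, continuous (pi_map R)}.
Proof.
apply: continuous_in_subspaceT => p /set_mem[_ x0 y0].
rewrite /pi_map; apply: cvgM; first exact: cvg_snd.
apply: cvgV; first by apply: lt0r_neq0; lra.
by apply: cvgD; [exact: cvg_fst|exact: cvg_cst].
Qed.

Lemma continuous_pi_map_inv : {within `]0, 1[ : set R, continuous (pi_map_inv R)}.
Proof.
apply: continuous_in_subspaceT => t /set_mem; rewrite /= in_itv /= => /andP[t0 t1].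
have q0 := quad_gt0 t.
have c1 : (fun t : R => t) x @[x --> t] --> t by exact: cvg_id.
have c2 : (fun t : R => t ^+ 2) x @[x --> t] --> t ^+ 2 by exact: exprn_continuous.
have c3 : (1 + x + x ^+ 2)^-1 @[x --> t] --> (1 + t + t ^+ 2)^-1.
  apply: cvgV; first exact: lt0r_neq0.
  by apply: cvgD => //; apply: cvgD => //; exact: cvg_cst.
have cx : (1 - x ^+ 2) / (1 + x + x ^+ 2) @[x --> t] --> (1 - t ^+ 2) / (1 + t + t ^+ 2).
  by apply: cvgM => //; apply: cvgB => //; exact: cvg_cst.
have cy : (x ^+ 2 + 2 * x) / (1 + x + x ^+ 2) @[x --> t] -->
    (t ^+ 2 + 2 * t) / (1 + t + t ^+ 2).
  by apply: cvgM => //; apply: cvgD => //; apply: cvgM => //; exact: cvg_cst.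
exact: cvg_pair cx cy.
Qed.

Lemma T2_conjugate : conjugate_off_finite (FA R) (`]0, 1[ : set R)
  (corresponding_map (genNR R)) (T2 R) (pi_map R) (pi_map_inv R).
Proof.
split.
  split.
  - split=> [_ [p /pi_map_FA[t0 t1] <-]|_ [t /= + <-]]; rewrite /= in_itv /=.
      by rewrite t0.
    by move=> /andP[]; exact: FA_pi_map_inv.
  - split; first exact: pi_map_invK.
    by move=> t; rewrite /= in_itv /= => /andP[]; exact: pi_mapK.
  - exact: continuous_pi_map.
  - exact: continuous_pi_map_inv.
apply: (@sub_finite_set _ _ [set` [:: 1 / 4; 1 / 3; 2 / 5; 1 / 2 : R]]); last exact: finite_seq.
move=> t [/=]; rewrite in_itv /= => /andP[t0 t1] ne; apply: outside_T2_dom => //.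
move=> /T2_domP[i [s [s0 s1 e]]]; apply: ne.
by rewrite e T2_branch // corresponding_map_branch // pi_mapK.
Qed.

End Conjugacy.

(** * Lebesgue measure under expanding maps; uniqueness of measures on (0, 1) *)

Section LebesgueTools.
Variable R : realType.
Local Notation lambda := (@lebesgue_measure R).
Local Open Scope ereal_scope.

(** Cover [B] by half-open intervals, as in the definition of outer measure. The points of [C] sent
    into an interval of length l are at mutual distance at most L l, so they lie in a closed
    interval of length 2 L l centred at any one of them; hence the factor 2. *)
Lemma expanding_lebesgue_measure_le (f : R -> R) (L : R) (C B : set R) :
  measurable C -> (0 < L)%R ->
  (forall s t, C s -> C t -> (`|s - t| <= L * `|f s - f t|)%R) ->
  f @` C `<=` B -> lambda C <= (2 * L)%:E * lambda B.
Proof.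
move=> mC L0 fL fCB; have L20 : (0 < 2 * L)%R by lra.
rewrite -lee_pdivrMl //.
have -> : lambda B = mu_ext (wlength idfun) B by [].
apply: le_ereal_inf_tmp => _ [A [mA BA] <-].
rewrite lee_pdivrMl // -nneseriesZl; last by move=> k _; exact: wlength_ge0.
have /choice[U UA] (k : nat) : exists U : set R, [/\ measurable U,
    C `&` f @^-1` A k `<=` U & lambda U <= (2 * L)%:E * wlength idfun (A k)].
  have [AE|/eqP/set0P[s [Cs Afs]]] := pselect ((C `&` f @^-1` A k) = set0).
    exists set0; split => //; first by rewrite AE.
    by rewrite measure0 mule_ge0 ?wlength_ge0// lee_fin ltW.
  have [AE|[x x12 AE]] := (ocitvP (A k)).1 (mA k).
    by move: Afs; rewrite /= AE.
  move: Afs; rewrite AE /= in_itv /= => /andP[s1 s2].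
  pose h := (L * (x.2 - x.1))%R.
  have h0 : (0 < h)%R by rewrite mulr_gt0 // subr_gt0.
  exists `[(s - h)%R, (s + h)%R]%classic; split.
  - exact: measurable_itv.
  - move=> t [Ct] /=; rewrite !in_itv /= => /andP[t1 t2].
    rewrite -ler_distlC; apply: le_trans (fL _ _ Cs Ct) _.
    by rewrite ler_pM2l // ler_norml; lra.
  - rewrite lebesgue_measure_itv /= wlength_itv /= !lte_fin x12.
    by rewrite ifT; [rewrite -!EFinB -EFinM lee_fin /h; lra|lra].
apply: le_trans (_ : lambda (\bigcup_k U k) <= _).
  apply: le_measure; rewrite ?inE //.
    by apply: bigcupT_measurable => k; have [] := UA k.
  move=> t Ct; have [k _ Ak] : (\bigcup_k A k) (f t) by apply: BA; apply: fCB; exists t.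
  by exists k => //; have [_ + _] := UA k; apply.
apply: le_trans (_ : \sum_(0 <= k <oo) lambda (U k) <= _).
  apply: measure_sigma_subadditive => //.
  - by move=> k; have [] := UA k.
  - by apply: bigcupT_measurable => k; have [] := UA k.
apply: lee_nneseries => [k *|k *]; first exact: measure_ge0.
by have [] := UA k.
Qed.

(** These intervals stay away from 0 and 1, where [mu] has infinite mass. The shift by 3 makes them
    non-empty from n = 0 on. *)
Definition exhaust (n : nat) : set (measurableTypeR R) :=
  `](n.+3%:R^-1)%R, (1 - n.+3%:R^-1)%R]%classic.

Lemma exhaust_bounds n :
  [/\ (0 < n.+3%:R^-1 :> R)%R, (n.+3%:R^-1 < 1 - n.+3%:R^-1 :> R)%R &
       (1 - n.+3%:R^-1 < 1 :> R)%R].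
Proof.
have h0 : (0 < n.+3%:R^-1 :> R)%R by rewrite invr_gt0.
have : (n.+3%:R^-1 <= 1 / 3 :> R)%R by rewrite div1r lef_pV2 ?posrE// ler_nat.
by move: (n.+3%:R^-1)%R h0 => e h0 h1; split; lra.
Qed.

Lemma measurable_exhaust n : measurable (exhaust n).
Proof. exact: measurable_itv. Qed.

Lemma exhaust_nondecreasing : nondecreasing_seq exhaust.
Proof.
move=> n k nk; apply/subsetPset => t; rewrite /exhaust /= !in_itv /=.
have : (k.+3%:R^-1 <= n.+3%:R^-1 :> R)%R by rewrite lef_pV2 ?posrE// ler_nat; lia.
by move: (n.+3%:R^-1)%R (k.+3%:R^-1)%R => e e' h /andP[h1 h2]; apply/andP; split; lra.
Qed.

Lemma bigcup_exhaust : \bigcup_n exhaust n = `]0%R, 1%R[%classic.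
Proof.
apply/seteqP; split=> t.
  move=> [n _]; rewrite /exhaust /= !in_itv /= => /andP[h1 h2].
  have [h3 h4 h5] := exhaust_bounds n.
  by rewrite (lt_trans h3 h1) (le_lt_trans h2 h5).
rewrite /= in_itv /= => /andP[t0 t1].
have t1' : (0 < 1 - t)%R by lra.
pose n := (Num.bound t^-1 + Num.bound (1 - t)^-1)%N.
exists n => //; rewrite /exhaust /= in_itv /=.
have h1 : (t^-1 < n.+3%:R)%R.
  apply: lt_le_trans (archi_boundP _) _; first by rewrite invr_ge0 ltW.
  by rewrite ler_nat /n; lia.
have h2 : ((1 - t)^-1 < n.+3%:R)%R.
  apply: lt_le_trans (archi_boundP _) _; first by rewrite invr_ge0 ltW.
  by rewrite ler_nat /n; lia.
rewrite invf_plt ?posrE // in h1; rewrite invf_plt ?posrE // in h2.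
by move: (n.+3%:R^-1)%R h1 h2 => e h1 h2; apply/andP; split; lra.
Qed.

Lemma cvg_measure_exhaust (m : {measure set (measurableTypeR R) -> \bar R}) A :
  measurable A -> A `<=` (`]0%R, 1%R[%classic : set (measurableTypeR R)) ->
  m (A `&` exhaust n) @[n --> \oo] --> m A.
Proof.
move=> mA A01.
have mAD n : measurable (A `&` exhaust n) by exact: measurableI (measurable_exhaust n).
have {2}-> : A = \bigcup_n (A `&` exhaust n).
  by rewrite -setI_bigcupr bigcup_exhaust setIidl.
apply: nondecreasing_cvg_mu => //; first exact: bigcupT_measurable.
move=> n k /exhaust_nondecreasing /subsetPset nk.
by apply/subsetPset; exact: setIS.
Qed.

(** The measures may be infinite on (0, 1), so the uniqueness theorem is applied to their
    restrictions to each [exhaust n], and continuity from below gives the limit. *)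
Lemma measure_unique_itv01 (m1 m2 : {measure set (measurableTypeR R) -> \bar R}) :
  (forall a b : R, (0 < a)%R -> (a < b)%R -> (b < 1)%R ->
    m1 (`]a, b]%classic : set (measurableTypeR R)) < +oo /\
    m1 (`]a, b]%classic : set (measurableTypeR R)) =
    m2 (`]a, b]%classic : set (measurableTypeR R))) ->
  forall A, measurable A -> A `<=` (`]0%R, 1%R[%classic : set (measurableTypeR R)) ->
  m1 A = m2 A.
Proof.
move=> m12 A mA A01.
have Doo n : m1 (exhaust n) < +oo.
  by have [h0 h1 h2] := exhaust_bounds n; have [] := m12 _ _ h0 h1 h2.
have AD n : m1 (A `&` exhaust n) = m2 (A `&` exhaust n).
  have := @measure_unique _ R (measurableTypeR R) (@ocitv R)
    (fun k => `](- k%:R)%R, k%:R]%classic) _ _ _ _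
    (mrestr m1 (measurable_exhaust n)) (mrestr m2 (measurable_exhaust n)).
  apply => //.
  - exact: ocitvI.
  - by move=> k; exact: is_ocitv.
  - apply/seteqP; split => // x _; exists (Num.bound `|x|) => //=.
    rewrite in_itv /=; have := archi_boundP (normr_ge0 x).
    by rewrite ltr_norml => /andP[-> /ltW ->].
  - move=> _ [[x y] _ <-] /=; rewrite /mrestr.
    have -> : `]x, y]%classic `&` exhaust n =
        `](Num.max x (n.+3%:R^-1))%R, (Num.min y (1 - n.+3%:R^-1))%R]%classic.
      apply/seteqP; split => t; rewrite /exhaust /= !in_itv /= gt_max le_min.
        by move=> [/andP[-> ->] /andP[-> ->]].
      by move=> /andP[/andP[-> ->] /andP[-> ->]].
    have [h0 h1 h2] := exhaust_bounds n.
    have [xy|xy] := ltP (Num.max x (n.+3%:R^-1))%R (Num.min y (1 - n.+3%:R^-1))%R.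
      apply m12 => //; first by rewrite lt_max h0 orbT.
      by rewrite gt_min h2 orbT.
    by rewrite set_itv_ge ?measure0 // bnd_simp -leNgt.
  - move=> k; apply: le_lt_trans (Doo n); apply: le_measure; rewrite ?inE//.
      by apply: measurableI; [exact: measurable_itv|exact: measurable_exhaust].
    exact: measurable_exhaust.
have := @cvg_measure_exhaust m1 _ mA A01; under eq_fun do rewrite AD; move=> h.
exact: cvg_unique h (@cvg_measure_exhaust m2 _ mA A01).
Qed.

End LebesgueTools.

(** * An antiderivative of the invariant density *)

Section InvariantDensity.
Variable R : realType.

(** The logarithm of the odds t / (1 - t), an antiderivative of [density]. *)
Definition logit (t : R) : R := ln t - ln (1 - t).

Lemma is_derive_logit (t : R) : 0 < t -> t < 1 -> is_derive t 1 logit (density t).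
Proof.
move=> t0 t1; have t1' : 0 < 1 - t by lra.
have h1 := is_derive1_ln t0.
have h2 : is_derive t 1 (fun x : R => ln (1 - x)) (- (1 - t)^-1).
  have h := is_derive1_ln t1'.
  have h' : is_derive t 1 (fun x : R => 1 - x) (-1).
    by apply: is_derive_eq; ring.
  have := @is_derive1_comp R (@ln R) (fun x : R => 1 - x) t _ _ h h'.
  by rewrite mulrN1.
rewrite /logit; apply: is_derive_eq; rewrite /density opprK; field; nonzero.
Qed.

(** The booleans choose open or closed ends. Endpoints do not affect the integral, so the
    fundamental theorem of calculus on the closed interval covers all cases. *)
Lemma mu_itvE (x y : bool) (a b : R) : 0 < a -> a < b -> b < 1 ->
  mu R [set` Interval (BSide x a) (BSide y b)] = (logit b - logit a)%:E.
Proof.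
move=> a0 ab b1; rewrite /mu setIidl; last first.
  move=> t; rewrite /= !in_itv /= => /andP[h1 h2].
  have {}h1 : a <= t by case: (x) h1 => //= /ltW.
  have {}h2 : t <= b by case: (y) h2 => //= /ltW.
  by apply/andP; split; lra.
have cd (t : R) : 0 < t -> t < 1 -> density x @[x --> t] --> density t.
  move=> t0 t1; apply: cvgM; first exact: cvg_cst.
  apply: cvgV; first by rewrite mulf_neq0 ?gt_eqF ?subr_gt0.
  by apply: cvgM; [exact: cvg_id|apply: cvgB; [exact: cvg_cst|exact: cvg_id]].
have cl (t : R) : 0 < t -> t < 1 -> logit x @[x --> t] --> logit t.
  move=> t0 t1; have [h _] := is_derive_logit t0 t1.
  exact/differentiable_continuous/derivable1_diffP.
have mf : measurable_fun (`]a, b[%classic : set (measurableTypeR R)) (EFin \o @density R).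
  apply/measurable_EFinP; apply: open_continuous_measurable_fun; first exact: interval_open.
  move=> t; rewrite inE /= in_itv /= => /andP[h1 h2]; apply: cd; lra.
rewrite integral_itv_bndoo // -(@integral_itv_bndoo _ _ _ _ true false) //.
rewrite (@continuous_FTC2 _ _ logit) //.
- apply: continuous_in_subspaceT => t /set_mem; rewrite /= in_itv /= => /andP[h1 h2].
  apply: cd; lra.
- split.
  + move=> t; rewrite in_itv /= => /andP[h1 h2].
    have t0 : 0 < t by lra. have t1 : t < 1 by lra.
    by have [] := is_derive_logit t0 t1.
  + by apply: cvg_at_right_filter; apply: cl; lra.
  + by apply: cvg_at_left_filter; apply: cl; lra.
- move=> t; rewrite in_itv /= => /andP[h1 h2].
  have t0 : 0 < t by lra. have t1 : t < 1 by lra.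
  by rewrite derive1E; have [_ ->] := is_derive_logit t0 t1.
Qed.

End InvariantDensity.

(** * Sigma-finiteness, null sets and measurability of T_2 *)

Section InvariantMeasure.
Variable R : realType.
Local Notation lambda := (@lebesgue_measure R).
Local Notation RR := (measurableTypeR R).
Local Notation I01 := (`]0%R, 1%R[%classic : set RR).

Lemma measurable_density01 : measurable_fun I01 (EFin \o @density R).
Proof.
apply/measurable_EFinP; apply: open_continuous_measurable_fun; first exact: interval_open.
move=> t; rewrite inE /= in_itv /= => /andP[t0 t1].
apply: cvgM; first exact: cvg_cst.
apply: cvgV; first by rewrite mulf_neq0 ?gt_eqF ?subr_gt0.
by apply: cvgM; [exact: cvg_id|apply: cvgB; [exact: cvg_cst|exact: cvg_id]].
Qed.

Lemma mu_setI01 A : mu R A = mu R (A `&` I01).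
Proof. by rewrite /mu -setIA setIid. Qed.

Lemma mu_null A : measurable A -> lambda A = 0%E -> mu R A = 0%E.
Proof.
move=> mA A0; rewrite /mu; apply: null_set_integral.
- by apply: measurableI => //; exact: measurable_itv.
- by apply: measurable_funS measurable_density01 => //; exact: measurable_itv.
- by apply: subset_measure0 A0 => //; apply: measurableI => //; exact: measurable_itv.
Qed.

Lemma mu_exhaust_lty n : (mu R (@exhaust R n) < +oo)%E.
Proof.
have [h0 h1 h2] := @exhaust_bounds R n.
by rewrite /exhaust mu_itvE // ltry.
Qed.

Lemma sigma_finite_mu : sigma_finite I01 (mu R).
Proof.
exists (@exhaust R); first by rewrite bigcup_exhaust.
by move=> n; split; [exact: measurable_exhaust|exact: mu_exhaust_lty].
Qed.

Lemma branch_rational i (s : R) : range (@ratr R) s -> range (@ratr R) (branch i s).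
Proof.
case=> q _ <-; elim/ord5P: i; rewrite /branch sel5E.
- by exists (q / (1 + 3 * q)) => //;
    rewrite fmorph_div !(rmorphB, rmorphD, rmorphM, rmorph1, ratr_nat) /=.
- by exists (1 / (q + 3)) => //;
    rewrite fmorph_div !(rmorphB, rmorphD, rmorphM, rmorph1, ratr_nat) /=.
- by exists ((1 + q) / (3 + 2 * q)) => //;
    rewrite fmorph_div !(rmorphB, rmorphD, rmorphM, rmorph1, ratr_nat) /=.
- by exists ((1 + q) / (2 + 3 * q)) => //;
    rewrite fmorph_div !(rmorphB, rmorphD, rmorphM, rmorph1, ratr_nat) /=.
- by exists (1 / (2 - q)) => //;
    rewrite fmorph_div !(rmorphB, rmorphD, rmorphM, rmorph1, ratr_nat) /=.
Qed.

(** The cut points are rational, and a rational value of [T2] would make t rational through its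
    inverse branch. Irrational points therefore have infinite orbits, and [T2_space] has full
    measure. *)
Lemma irrational_T2_dom (t : R) : I01 t -> ~ range (@ratr R) t ->
  [/\ T2_dom t, I01 (T2 R t) & ~ range (@ratr R) (T2 R t)].
Proof.
rewrite /= in_itv /= => /andP[t0 t1] tQ.
have tD : T2_dom t.
  apply: contrapT => /(outside_T2_dom t0 t1); rewrite !inE => h; apply: tQ.
  case/or4P: h => /eqP ->.
  - by exists (1 / 4) => //; rewrite fmorph_div rmorph1 ratr_nat.
  - by exists (1 / 3) => //; rewrite fmorph_div rmorph1 ratr_nat.
  - by exists (2 / 5) => //; rewrite fmorph_div !ratr_nat.
  - by exists (1 / 2) => //; rewrite fmorph_div rmorph1 ratr_nat.
have /T2_domP[i [s [s0 s1 e]]] := tD.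
split=> //; rewrite e T2_branch //; first by rewrite /= in_itv /= s0.
by move=> /(branch_rational i); rewrite -e.
Qed.

Lemma irrational_T2_space (t : R) : I01 t -> ~ range (@ratr R) t -> T2_space R t.
Proof.
move=> t01 tQ n.
suff [h1 h2] : I01 (iter n (T2 R) t) /\ ~ range (@ratr R) (iter n (T2 R) t).
  by have [] := irrational_T2_dom h1 h2.
elim: n => [|n [h1 h2]] //=.
by have [] := irrational_T2_dom h1 h2.
Qed.

Lemma T2_space_sub01 : T2_space R `<=` I01.
Proof.
move=> t /(_ 0%N) /T2_domP[i [s [s0 s1 /= ->]]].
by rewrite /= in_itv /=; exact: branch01.
Qed.

Lemma T2_space_T2 t : T2_space R t -> T2_space R (T2 R t).
Proof. by move=> tX n; rewrite -iterSr; exact: tX. Qed.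

Lemma T2_space_iter n t : T2_space R t -> T2_space R (iter n (T2 R) t).
Proof. by elim: n t => //= n ih t tX; apply: T2_space_T2; exact: ih. Qed.

Lemma measurable_rational : measurable (range (@ratr R) : set RR).
Proof.
apply: countable_measurable; first by move=> t; exact: measurable_set1.
by apply: card_le_trans (card_image_le _ _) _; exact/countableP.
Qed.

Lemma negligible_T2_space : lambda.-negligible (I01 `\` T2_space R).
Proof.
exists (range ratr); split; first exact: measurable_rational.
  exact: lebesgue_measure_rat.
by move=> t [t01 tX]; apply: contrapT => tQ; apply: tX; exact: irrational_T2_space.
Qed.

Lemma measurable_T2_piece i :
  measurable_fun (`]branch_lo R i, branch_hi R i[%classic : set RR) (T2 R : RR -> RR).
Proof.
pose f (t : R) := sel5 t (1 - 3 * t) (3 * t - 1) (1 - 2 * t) (2 * t - 1) i.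
pose g (t : R) := sel5 (1 - 3 * t) t (1 - 2 * t) (3 * t - 1) t i.
apply: (@eq_measurable_fun _ _ RR RR _ (fun t => f t / g t)).
  move=> t; rewrite inE /= in_itv /= => /andP[h1 h2]; rewrite (T2E h1 h2) /f /g.
  by elim/ord5P: i {f g h1 h2}; rewrite !sel5E.
apply: open_continuous_measurable_fun; first exact: interval_open.
have aff (a b x : R) : (fun t : R => a * t + b) t @[t --> x] --> a * x + b.
  by apply: cvgD; [apply: cvgM; [exact: cvg_cst|exact: cvg_id]|exact: cvg_cst].
move=> t; rewrite inE /= in_itv /= => /andP[h1 h2].
have cf : f x @[x --> t] --> f t.
  rewrite /f; elim/ord5P: i {f g h1 h2}; rewrite sel5E; under eq_fun do rewrite sel5E.
  - exact: cvg_id.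
  - by have := aff (- 3) 1 t; under eq_fun do rewrite mulNr addrC; rewrite mulNr addrC.
  - exact: aff.
  - by have := aff (- 2) 1 t; under eq_fun do rewrite mulNr addrC; rewrite mulNr addrC.
  - exact: aff.
have cg : g x @[x --> t] --> g t.
  rewrite /g; elim/ord5P: i {f g cf h1 h2}; rewrite sel5E; under eq_fun do rewrite sel5E.
  - by have := aff (- 3) 1 t; under eq_fun do rewrite mulNr addrC; rewrite mulNr addrC.
  - exact: cvg_id.
  - by have := aff (- 2) 1 t; under eq_fun do rewrite mulNr addrC; rewrite mulNr addrC.
  - exact: aff.
  - exact: cvg_id.
apply: cvgM => //; apply: cvgV => //; apply/eqP; move: h1 h2; rewrite /g /branch_lo /branch_hi.
by elim/ord5P: i {f g cf cg}; rewrite !sel5E => h1 h2 ?; lra.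
Qed.

Lemma measurable_T2_dom : measurable (@T2_dom R : set RR).
Proof. by rewrite /T2_dom; repeat (apply: measurableU); exact: measurable_itv. Qed.

Lemma measurable_T2 : measurable_fun setT (T2 R : RR -> RR).
Proof.
rewrite -(setUv (@T2_dom R)).
have mD := measurable_T2_dom; have mDC := measurableC mD.
apply/measurable_funU => //; split; last first.
  apply: (@eq_measurable_fun _ _ RR RR _ (cst (0 : R))) => //.
  by move=> t; rewrite inE => /T2_off_dom.
have := (@measurable_T2_piece 0, @measurable_T2_piece 1, @measurable_T2_piece 2,
  @measurable_T2_piece 3, @measurable_T2_piece 4).
rewrite /branch_lo /branch_hi !sel5E => -[[[[h0 h1] h2] h3] h4].
rewrite /T2_dom; apply/measurable_funU => //; last split => //.
  by repeat (apply: measurableU); exact: measurable_itv.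
apply/measurable_funU => //; last split => //.
  by repeat (apply: measurableU); exact: measurable_itv.
apply/measurable_funU => //; last split => //.
  by repeat (apply: measurableU); exact: measurable_itv.
by apply/measurable_funU.
Qed.

Lemma measurable_iter_T2 n : measurable_fun setT (iter n (T2 R) : RR -> RR).
Proof.
elim: n => [|n ih]; first exact: measurable_id.
by apply: measurableT_comp => //; exact: measurable_T2.
Qed.

Lemma measurable_iter_T2_preimage n (A : set RR) :
  measurable A -> measurable (iter n (T2 R) @^-1` A : set RR).
Proof. by move=> mA; rewrite -[X in measurable X]setTI; exact: measurable_iter_T2. Qed.

Lemma measurable_T2_space : measurable (T2_space R : set RR).
Proof.
rewrite (_ : T2_space R = \bigcap_n (iter n (T2 R) @^-1` (@T2_dom R))).
  apply: bigcapT_measurable => n; apply: measurable_iter_T2_preimage.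
  exact: measurable_T2_dom.
by apply/seteqP; split=> t tX n; [move=> _|]; apply: tX.
Qed.

Lemma mu_outside_T2_space (A : set RR) : measurable A -> A `&` T2_space R = set0 -> mu R A = 0%E.
Proof.
move=> mA AX; rewrite mu_setI01.
have mAI : measurable (A `&` I01) by apply: measurableI => //; exact: measurable_itv.
apply: mu_null => //; apply: (subset_measure0 mAI measurable_rational _ (lebesgue_measure_rat R)).
move=> t [At t01]; apply: contrapT => tQ.
by have : (A `&` T2_space R) t by [split => //; exact: irrational_T2_space]; rewrite AX.
Qed.

Lemma mu_setIX (A : set RR) : measurable A -> mu R (T2_space R `&` A) = mu R A.
Proof.
move=> mA; have mX := measurable_T2_space.
rewrite [in RHS](_ : A = (T2_space R `&` A) `|` (A `\` T2_space R)); last first.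
  by rewrite setIC setUIDK.
rewrite measureU; last 3 first.
- exact: measurableI.
- exact: measurableD.
- by apply/seteqP; split => // t [[h _] []].
rewrite [X in (_ + X)%E]mu_outside_T2_space ?adde0 //; first exact: measurableD.
by apply/seteqP; split => // t [[_ h]].
Qed.

End InvariantMeasure.

(** * Invariance of the measure *)

Section Invariance.
Variable R : realType.
Local Notation RR := (measurableTypeR R).
Local Notation I01 := (`]0%R, 1%R[%classic : set RR).

Lemma logit_odds (x y : R) : 0 < x -> 0 < y -> logit (x / (x + y)) = ln x - ln y.
Proof.
move=> x0 y0; have xy : 0 < x + y by lra.
rewrite /logit (_ : 1 - x / (x + y) = y / (x + y)); last by field; nonzero.
by rewrite !ln_div ?posrE //; ring.
Qed.

Lemma logit_branch_sum (s : R) : 0 < s -> s < 1 ->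
  logit (branch 0 s) - logit (branch 1 s) + logit (branch 2 s) - logit (branch 3 s)
    + logit (branch 4 s) = logit s.
Proof.
move=> s0 s1; rewrite /branch !sel5E.
(* Each denominator is split as numerator plus remainder, so that [logit_odds] reads off the odds;
   the factors 1 + s, 2 + s and 1 + 2 s then cancel. *)
rewrite (_ : 1 + 3 * s = s + (1 + 2 * s)); last by ring.
rewrite (_ : s + 3 = 1 + (s + 2)); last by ring.
rewrite (_ : 3 + 2 * s = (1 + s) + (2 + s)); last by ring.
rewrite (_ : 2 + 3 * s = (1 + s) + (1 + 2 * s)); last by ring.
rewrite (_ : 2 - s = 1 + (1 - s)); last by ring.
rewrite !logit_odds; try lra.
by rewrite /logit ln1 (addrC s 2); ring.
Qed.

(** Branches 1 and 3 are decreasing: they swap the endpoints and move the closed end to the left. *)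
Definition branch_image_oc (i : 'I_5) (a b : R) : interval R :=
  if i \in [:: 1; 3] then `[branch i b, branch i a[ else `]branch i a, branch i b].

Lemma T2_preimage_oc i (a b : R) : 0 < a -> a < b -> b < 1 ->
  T2 R @^-1` `]a, b] `&` `]branch_lo R i, branch_hi R i[ = [set` branch_image_oc i a b].
Proof.
move=> a0 ab b1.
have b0 : 0 < b by lra. have a1 : a < 1 by lra.
have hE t : branch_lo R i < t -> t < branch_hi R i ->
    (t \in branch_image_oc i a b) = (a < T2 R t) && (T2 R t <= b).
  move=> h1 h2; rewrite (T2E h1 h2) /branch_image_oc /branch; move: h1 h2.
  rewrite /branch_lo /branch_hi.
  elim/ord5P: i; rewrite !sel5E /= in_itv /= => h1 h2.
  - rewrite ltr_pdivrMr; last lra. rewrite ler_pdivlMr; last lra.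
    rewrite ltr_pdivlMr; last lra. rewrite ler_pdivrMr; last lra.
    by apply/andP/andP => -[? ?]; split; lra.
  - rewrite ltr_pdivlMr; last lra. rewrite ler_pdivrMr; last lra.
    rewrite ltr_pdivlMr; last lra. rewrite ler_pdivrMr; last lra.
    by apply/andP/andP => -[? ?]; split; lra.
  - rewrite ltr_pdivrMr; last lra. rewrite ler_pdivlMr; last lra.
    rewrite ltr_pdivlMr; last lra. rewrite ler_pdivrMr; last lra.
    by apply/andP/andP => -[? ?]; split; lra.
  - rewrite ltr_pdivlMr; last lra. rewrite ler_pdivrMr; last lra.
    rewrite ltr_pdivlMr; last lra. rewrite ler_pdivrMr; last lra.
    by apply/andP/andP => -[? ?]; split; lra.
  - rewrite ltr_pdivrMr; last lra. rewrite ler_pdivlMr; last lra.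
    rewrite ltr_pdivlMr; last lra. rewrite ler_pdivrMr; last lra.
    by apply/andP/andP => -[? ?]; split; lra.
have sub t : t \in branch_image_oc i a b -> branch_lo R i < t < branch_hi R i.
  have /andP[ha1 ha2] := branch_itv i a0 a1; have /andP[hb1 hb2] := branch_itv i b0 b1.
  by rewrite /branch_image_oc; case: ifP => _; rewrite in_itv /= => /andP[? ?]; lra.
apply/seteqP; split => t.
  move=> [h]; rewrite /= in_itv /= => /andP[h1 h2].
  by rewrite hE //; move: h; rewrite /= in_itv.
move=> /= h; have /andP[h1 h2] := sub _ h; move: h; rewrite hE // => h.
by rewrite !in_itv /= h1 h2.
Qed.

Lemma mu_branch_image_oc i (a b : R) : 0 < a -> a < b -> b < 1 ->
  mu R [set` branch_image_oc i a b] =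
  ((-1) ^+ (i \in [:: 1; 3]) * (logit (branch i b) - logit (branch i a)))%:E.
Proof.
move=> a0 ab b1.
have b0 : 0 < b by lra. have a1 : a < 1 by lra.
have /andP[ha1 ha2] := branch01 i a0 a1; have /andP[hb1 hb2] := branch01 i b0 b1.
have mono : if i \in [:: 1; 3] then branch i b < branch i a else branch i a < branch i b.
  have frac (x y z w : R) : 0 < y -> 0 < w -> x * w < z * y -> x / y < z / w.
    by move=> y0 w0 h; rewrite ltr_pdivrMr // mulrAC ltr_pdivlMr.
  by rewrite /branch; elim/ord5P: i {ha1 ha2 hb1 hb2}; rewrite !sel5E /=; apply: frac; nra.
move: mono; rewrite /branch_image_oc; case: ifP => _ mono.
  by rewrite mu_itvE //; congr EFin; rewrite /= expr1; ring.
by rewrite mu_itvE //; congr EFin; rewrite /= expr0; ring.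
Qed.

Lemma mu_T2_preimage_oc (a b : R) : 0 < a -> a < b -> b < 1 ->
  mu R (T2 R @^-1` `]a, b]) = mu R `]a, b]%classic.
Proof.
move=> a0 ab b1.
rewrite mu_setI01.
have -> : T2 R @^-1` `]a, b] `&` I01 =
    \big[setU/set0]_(i < 5) [set` branch_image_oc i a b].
  rewrite -bigcup_seq; apply/seteqP; split => t.
    move=> [h]; rewrite /= in_itv /= => /andP[t0 t1].
    have [tD|tD] := pselect (T2_dom t).
      have /T2_domE[i [h1 h2]] := tD; exists i; first by rewrite /= mem_index_enum.
      by rewrite -T2_preimage_oc //; split => //=; rewrite in_itv /= h1.
    (* Off its domain [T2] takes the dummy value 0, which is not in []a, b]]. *)
    by move: h; rewrite /= T2_off_dom // in_itv /= => /andP[? _]; lra.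
  move=> [i _]; rewrite -T2_preimage_oc // => -[h] /=; rewrite in_itv /= => /andP[h1 h2].
  split => //; have [h3 h4 <-] := branch_T2 h1 h2.
  by rewrite /= in_itv /=; exact: branch01.
rewrite measure_bigsetU_ord.
- rewrite (eq_bigr _ (fun i _ => mu_branch_image_oc i a0 ab b1)) mu_itvE // sumEFin.
  congr EFin.
  have a1 : a < 1 by lra. have b0 : 0 < b by lra.
  rewrite -(logit_branch_sum a0 a1) -(logit_branch_sum b0 b1).
  have ordE : [/\ lift ord0 (ord0 : 'I_4) = 1, lift ord0 (lift ord0 (ord0 : 'I_3)) = 2,
      lift ord0 (lift ord0 (lift ord0 (ord0 : 'I_2))) = 3
      & lift ord0 (lift ord0 (lift ord0 (lift ord0 (ord0 : 'I_1)))) = 4 :> 'I_5].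
    by split; exact/val_inj.
  have [e1 e2 e3 e4] := ordE.
  rewrite !big_ord_recl big_ord0 e1 e2 e3 e4 /= !expr1 !expr0; ring.
- by move=> i; exact: measurable_itv.
- move=> i j _ _ [t []]; rewrite -!T2_preimage_oc // => -[_ +] [_] /=; rewrite !in_itv /=.
  move=> /andP[h1 h2] /andP[h3 h4].
  have [s0 s1 e] := branch_T2 h1 h2; have [_ _ e'] := branch_T2 h3 h4.
  by apply: (branch_disjoint s0 s1 s0 s1); rewrite e e'.
Qed.

Lemma mu_T2_invariant : invariant_measure (mu R) (T2_space R) (T2 R).
Proof.
split.
  by apply: measurable_funTS; exact: measurable_T2.
move=> A mA AX; rewrite /preim_in.
have mTA : measurable (T2 R @^-1` A : set RR).
  by rewrite -[X in measurable X]setTI; exact: measurable_T2.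
apply: etrans (mu_setIX mTA) _.
(* The pushforward of [mu] under [T2] need only be compared with [mu] on intervals inside (0, 1). *)
pose nu := measure_function_pushforward__canonical__measure_function_Measure
  (mu R : {measure set RR -> \bar R}) (@measurable_T2 R).
change (nu A = mu R A); apply: measure_unique_itv01 => //.
- move=> a b a0 ab b1.
  have e : nu `]a, b]%classic = mu R `]a, b]%classic := mu_T2_preimage_oc a0 ab b1.
  have f : (mu R `]a, b]%classic < +oo)%E by rewrite mu_itvE // ltry.
  by split => //; rewrite e.
- exact: subset_trans AX (@T2_space_sub01 R).
Qed.

End Invariance.

(** * Recurrence to the core [1/5, 4/7] and conservativity *)

Section Recurrence.
Variable R : realType.
Local Notation lambda := (@lebesgue_measure R).
Local Notation RR := (measurableTypeR R).
Implicit Types s t x : R.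

(** In the coordinate 1 / t this piece is a translation by -3. As 1/2 < 4/7, a step from below the
    core cannot land above it. *)
Lemma T2_low t : 0 < t -> t < 1 / 5 ->
  T2 R t < 1 / 2 /\ (T2 R t)^-1 = t^-1 - 3.
Proof.
move=> t0 t1; have -> : T2 R t = t / (1 - 3 * t).
  by rewrite (@T2E _ 0) /branch_lo /branch_hi ?sel5E //; lra.
split; first by rewrite ltr_pdivrMr; lra.
by field; nonzero.
Qed.

Lemma T2_high t : 4 / 7 < t -> t < 1 ->
  1 / 4 < T2 R t /\ (1 - T2 R t)^-1 = (1 - t)^-1 - 1.
Proof.
move=> t0 t1; have -> : T2 R t = (2 * t - 1) / t.
  by rewrite (@T2E _ 4) /branch_lo /branch_hi ?sel5E //; lra.
split; first by rewrite ltr_pdivlMr; lra.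
by field; nonzero.
Qed.

(* A stretch of the orbit near the neutral fixed points 0 and 1 shifts [1 / t],
   respectively [1 / (1 - t)], by a constant at each step, hence terminates; the
   interval [1/5, 4/7] is too wide to be jumped over. *)
Lemma T2_visits_core t : T2_space R t ->
  exists n, 1 / 5 <= iter n (T2 R) t <= 4 / 7.
Proof.
move=> tX.
have low m : forall t, T2_space R t -> t <= 4 / 7 -> t^-1 < m%:R ->
    exists n, 1 / 5 <= iter n (T2 R) t <= 4 / 7.
  elim: m => [|m ih] s sX s1 sm; have := T2_space_sub01 sX;
    rewrite /= in_itv /= => /andP[s0 _].
    by move: sm; rewrite ltNge invr_ge0 ltW.
  have [s5|s5] := leP (1 / 5) s; first by exists 0%N; rewrite /= s5.
  have [Ts TsV] := T2_low s0 s5.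
  have [||n hn] := ih _ (T2_space_T2 sX); first lra.
    by rewrite TsV; rewrite -natr1 in sm; lra.
  by exists n.+1; rewrite iterSr.
have high m : forall t, T2_space R t -> 1 / 5 <= t -> (1 - t)^-1 < m%:R ->
    exists n, 1 / 5 <= iter n (T2 R) t <= 4 / 7.
  elim: m => [|m ih] s sX s1 sm; have := T2_space_sub01 sX;
    rewrite /= in_itv /= => /andP[_ s0].
    by move: sm; rewrite ltNge invr_ge0 subr_ge0 ltW.
  have [s5|s5] := leP s (4 / 7); first by exists 0%N; rewrite /= s1.
  have [Ts TsV] := T2_high s5 s0.
  have [||n hn] := ih _ (T2_space_T2 sX); first lra.
    by rewrite TsV; rewrite -natr1 in sm; lra.
  by exists n.+1; rewrite iterSr.
have := T2_space_sub01 tX; rewrite /= in_itv /= => /andP[t0 t1].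
have [t47|t47] := leP t (4 / 7).
  by apply: (low (Num.bound t^-1)) => //; apply: archi_boundP; rewrite invr_ge0 ltW.
apply: (high (Num.bound (1 - t)^-1)) => //; first lra.
by apply: archi_boundP; rewrite invr_ge0; lra.
Qed.

Lemma T2_visits_core_io t N : T2_space R t ->
  exists2 n, (N <= n)%N & 1 / 5 <= iter n (T2 R) t <= 4 / 7.
Proof.
move=> tX; have [n hn] := T2_visits_core (T2_space_iter N tX).
by exists (n + N)%N; [exact: leq_addl|rewrite iterD].
Qed.

Lemma preim_in_iter_measurable n (A : set RR) : measurable A ->
  measurable (preim_in (T2_space R : set RR) (iter n (T2 R)) A).
Proof.
move=> mA; apply: measurableI; first exact: measurable_T2_space.
exact: measurable_iter_T2_preimage.
Qed.

Lemma mu_iter_T2 n (A : set RR) : measurable A -> A `<=` T2_space R ->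
  mu R (preim_in (T2_space R : set RR) (iter n (T2 R)) A) = mu R A.
Proof.
elim: n A => [|n ih] A mA AX.
  by congr (mu R _); apply/seteqP; split => [t []|t At] //; split => //; exact: AX.
rewrite -[RHS]ih // -[RHS](mu_T2_invariant R).2.
- congr (mu R _); apply/seteqP; split => t [tX]; rewrite /= -?iterSr => h.
    by split => //; split; [exact: T2_space_T2|rewrite /= -iterSr].
  by case: h => _ h; split => //; rewrite /= in h *; rewrite -iterS iterSr.
- exact: preim_in_iter_measurable.
- by move=> t [].
Qed.

(** Every point of a wandering set [W] visits the core infinitely often. The sets [V n] of points of
    [W] in the core at time n have total measure at most that of the core, which is finite, so
    Borel-Cantelli makes [W] null. *)
Lemma mu_T2_conservative : conservative_measure (mu R) (T2_space R) (T2 R).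
Proof.
case=> W [mW WX W0 tW].
pose core : set RR := T2_space R `&` `[1 / 5, 4 / 7]%classic.
have mcore : measurable core.
  by apply: measurableI; [exact: measurable_T2_space|exact: measurable_itv].
have coreX : core `<=` T2_space R by move=> t [].
have core_fin : (mu R core < +oo)%E.
  apply: (@le_lt_trans _ _ (mu R `[1 / 5, 4 / 7]%classic)); last first.
    by rewrite mu_itvE ?ltry //; lra.
  by apply: le_measure; rewrite ?inE //; move=> t [].
pose V n := W `&` preim_in (T2_space R : set RR) (iter n (T2 R)) core.
have mV n : measurable (V n).
  by apply: measurableI => //; exact: preim_in_iter_measurable.
have VX n : V n `<=` T2_space R by move=> t [/WX].
(* Pulling [V n] back by the remaining [N - n] steps makes these sets disjoint
   subsets of one preimage of the core. *)
have sumV N : (\sum_(0 <= n < N) mu R (V n) <= mu R core)%E.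
  rewrite big_mkord.
  pose U (n : 'I_N) := preim_in (T2_space R : set RR) (iter (N - n) (T2 R)) (V n).
  have mU n : measurable (U n) by exact: preim_in_iter_measurable.
  rewrite (eq_bigr (fun n => mu R (U n))); last by move=> n _; rewrite mu_iter_T2.
  rewrite -measure_bigsetU_ord //; last first.
    move=> i j _ _ [t [[tX [Wi _]] [_ [Wj _]]]].
    (* A common point lies in [W] at times N - i and N - j, and the preimages of [W] are pairwise
       disjoint. *)
    have ij : (N - i = N - j)%N.
      by apply: (tW (N - i)%N (N - j)%N) => //; exists t; split; split.
    apply/ord_inj; move: ij (ltn_ord i) (ltn_ord j).
    by move: (nat_of_ord i) (nat_of_ord j) => p q; lia.
  rewrite -[leRHS](mu_iter_T2 N) //; apply: le_measure; rewrite ?inE.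
  - by apply: bigsetU_measurable => i _.
  - exact: preim_in_iter_measurable.
  - rewrite -bigcup_seq => t [i _ [tX [_ [_]]]] /=.
    by rewrite -iterD subnKC ?(ltnW (ltn_ord i)) // => h; split.
have V_io : W `<=` lim_sup_set V.
  move=> t Wt N _; have [n Nn hn] := T2_visits_core_io N (WX _ Wt).
  exists n => //; split => //; split; first exact: WX.
  by split; [exact: T2_space_iter (WX _ Wt)|rewrite /= in_itv].
have : (mu R W <= mu R (lim_sup_set V))%E.
  apply: le_measure; rewrite ?inE //.
  by apply: bigcap_measurable => // k _; exact: bigcup_measurable.
rewrite (lim_sup_set_cvg0 mV).
  by rewrite leNgt W0.
apply: le_lt_trans core_fin; apply: lime_le; first exact: is_cvg_nneseries.
by apply: nearW => N; exact: sumV.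
Qed.

End Recurrence.

(** * Bounded distortion and ergodicity *)

Section Ergodicity.
Variable R : realType.
Local Notation lambda := (@lebesgue_measure R).
Local Notation RR := (measurableTypeR R).
Implicit Types s t x : R.

Definition backward_stable (E : set R) := forall i s, 0 < s -> s < 1 -> E s -> E (branch i s).

Lemma mobius_frac (a b c d p q : R) : 0 < q -> 0 < c * (p / q) + d ->
  (a * (p / q) + b) / (c * (p / q) + d) = (a * p + b * q) / (c * p + d * q).
Proof.
move=> q0 h; have qn0 := lt0r_neq0 q0.
have cdE : c * (p / q) + d = (c * p + d * q) / q by field.
have : c * p + d * q != 0.
  by apply: contraTneq h => h; rewrite cdE h mul0r ltxx.
rewrite cdE => h2; field; by rewrite h2.
Qed.

(* [d] and [c + d] are the denominators of the images of 0 and 1; they stay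
   positive and their sum grows along the orbit, although [c] may be negative. *)
Lemma inverse_branch n x : T2_space R x -> exists a b c d : R,
  [/\ (a * d - b * c) ^+ 2 = 1, 1 <= d, 1 <= c + d, n.+2%:R <= c + 2 * d &
   forall psi, psi = (fun s => (a * s + b) / (c * s + d)) ->
     x = psi (iter n (T2 R) x) /\
     forall E, backward_stable E -> forall s, 0 < s -> s < 1 -> E s -> E (psi s)].
Proof.
move=> xX; elim: n => [|n [a [b [c [d [det d1 cd1 D psiP]]]]]].
  exists 1, 0, 0, 1; split; rewrite ?mul0r; try lra.
  move=> _ ->; rewrite /=; split; first by field.
  by move=> E _ s s0 s1; rewrite mul1r mul0r !(addr0, add0r) divr1.
have [e hE] := psiP _ erefl.
have yX := T2_space_iter n xX.
have /T2_domP[i [s [s0 s1 ys]]] := yX 0%N.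
rewrite /= in ys.
have iterE : iter n.+1 (T2 R) x = s by rewrite /= ys T2_branch.
have denom t : 0 < t -> t < 1 -> 0 < c * t + d.
  move=> t0 t1; have : 0 < (1 - t) * d + t * (c + d); last by lra.
  by apply: addr_gt0; apply: mulr_gt0; lra.
(* The primed entries form the product of the matrix of psi with the matrix of [branch i], whose
   determinant is 1 or -1. *)
pose a' := sel5 (a + 3 * b) b (a + 2 * b) (a + 3 * b) (- b) i.
pose b' := sel5 b (a + 3 * b) (a + 3 * b) (a + 2 * b) (a + 2 * b) i.
pose c' := sel5 (c + 3 * d) d (c + 2 * d) (c + 3 * d) (- d) i.
pose d' := sel5 d (c + 3 * d) (c + 3 * d) (c + 2 * d) (c + 2 * d) i.
have psiE t : 0 < t -> t < 1 ->
    (a * branch i t + b) / (c * branch i t + d) = (a' * t + b') / (c' * t + d').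
  move=> t0 t1; have /andP[b0 b1] := branch01 i t0 t1; have := denom _ b0 b1.
  rewrite /a' /b' /c' /d' /branch.
  by elim/ord5P: i {ys a' b' c' d' b0 b1}; rewrite !sel5E => h;
    (rewrite mobius_frac //; [congr (_ / _); ring|lra]).
exists a', b', c', d'; split.
- rewrite /a' /b' /c' /d'; rewrite -[RHS]det.
  by elim/ord5P: i {ys a' b' c' d' psiE}; rewrite !sel5E; ring.
- by rewrite /d'; elim/ord5P: i {ys a' b' c' d' psiE}; rewrite !sel5E; lra.
- by rewrite /c' /d'; elim/ord5P: i {ys a' b' c' d' psiE}; rewrite !sel5E; lra.
- rewrite -natr1 /c' /d'; rewrite -natr1 in D.
  by elim/ord5P: i {ys a' b' c' d' psiE}; rewrite !sel5E; lra.
move=> _ ->; rewrite iterE; split; first by rewrite -psiE // -ys.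
move=> E ES t t0 t1 Et; rewrite -psiE //.
have /andP[b0 b1] := branch01 i t0 t1.
by apply: hE => //; exact: ES.
Qed.

Lemma invariant_backward_stable (E : set R) : E `<=` T2_space R ->
  preim_in (T2_space R : set RR) (T2 R) E = E -> backward_stable E.
Proof.
move=> EX EE i s s0 s1 Es; rewrite -EE; split; last by rewrite /= T2_branch.
case=> [|n]; first by apply/T2_domP; exists i, s.
by rewrite iterSr T2_branch //; exact: EX.
Qed.

Lemma measure_exhaust_neq0 (m : {measure set RR -> \bar R}) (E : set RR) :
  measurable E -> E `<=` `]0, 1[%classic -> m E != 0%E ->
  exists n, m (E `&` @exhaust R n) != 0%E.
Proof.
move=> mE E01; apply: contraNP => /forallNP h; apply/eqP.
have h0 n : m (E `&` @exhaust R n) = 0%E by apply: contrapT => /eqP; exact: h.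
have := @cvg_measure_exhaust R m E mE E01; under eq_fun do rewrite h0.
by move=> c; exact: cvg_unique c (cvg_cst _).
Qed.

(* The images of [exhaust m] under the inverse branches that return to [x] from the
   core shrink to [x], and by bounded distortion [E] fills a fixed proportion of
   them, so no point of [T2_space] is a dispersion point of [E]. *)
Lemma invariant_density_bound (E : set RR) m x : measurable E -> backward_stable E ->
  E `<=` T2_space R -> T2_space R x -> lambda (E `&` @exhaust R m) != 0%E ->
  exists2 k : R, 0 < k & forall rho, 0 < rho ->
    exists r, [/\ 0 < r, r < rho & (k%:E * lambda (ball x r) <= lambda (E `&` ball x r))%E].
Proof.
move=> mE ES EX xX C0.
have [e0 e1 e2] := @exhaust_bounds R m.
set e := m.+3%:R^-1 in e0 e1 e2.
pose C := E `&` @exhaust R m.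
have mC : measurable C by apply: measurableI => //; exact: measurable_exhaust.
have C_fin : (lambda C < +oo)%E.
  apply: (@le_lt_trans _ _ (lambda (@exhaust R m))).
    by apply: le_measure; rewrite ?inE //; [exact: measurable_exhaust|move=> t []].
  by rewrite lebesgue_measure_itv /=; case: ifP => _; rewrite ?ltry // -EFinB ltry.
have CE : lambda C = (fine (lambda C))%:E by rewrite fineK // ge0_fin_numE.
set v := fine (lambda C) in CE.
have v0 : 0 < v.
  by rewrite -lte_fin -CE lt0e C0 measure_ge0.
(* The constant is the ratio of the lower bound v / (2 S^2) for the part of [E] in the ball to the
   ball's length 2 r = 10 / (e S^2); it does not depend on S. *)
exists (v * e / 20); first by rewrite !(mulr_gt0, divr_gt0).
move=> rho rho0.
(* A return time to the core so late that S >= n + 2 exceeds 5 / (e rho), which makes r < rho. *)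
have [n Nn /andP[u0 u1]] := T2_visits_core_io (Num.bound (5 / (e * rho))) xX.
have [a [b [c [d [det d1 cd1 D /(_ _ erefl)]]]]] := inverse_branch n xX.
pose psi s := (a * s + b) / (c * s + d).
set u := iter n (T2 R) x in u0 u1 *; move=> [xE psiS].
rewrite -/(psi u) in xE.
(* The sum of the denominators at 0 and 1. On (0, 1) it bounds c s + d from above, and on [q, 1 - q]
   the denominator is at least q S. *)
pose S := c + 2 * d.
have S2 : 2 <= S by rewrite /S; lra.
have S0 : 0 < S by lra.
pose r := 5 / (e * S ^+ 2).
have r0 : 0 < r by rewrite divr_gt0 // mulr_gt0 // exprn_gt0 //; lra.
have den_le s : 0 < s -> s < 1 -> c * s + d <= S.
  move=> s0 s1; rewrite /S -subr_ge0.
  rewrite (_ : _ - _ = (1 - s) * (c + d) + s * d); last by ring.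
  by apply: addr_ge0; apply: mulr_ge0; lra.
have den_ge q s : q <= s -> q <= 1 - s -> q * S <= c * s + d.
  move=> s0 s1; rewrite /S -subr_ge0.
  rewrite (_ : _ - _ = (1 - s - q) * d + (s - q) * (c + d)); last by ring.
  by apply: addr_ge0; apply: mulr_ge0; lra.
have den_gt0 s : 0 < s -> s < 1 -> 0 < c * s + d.
  move=> s0 s1; rewrite (_ : _ + _ = (1 - s) * d + s * (c + d)); last by ring.
  by apply: addr_gt0; apply: mulr_gt0; lra.
have det1 : `|a * d - b * c| = 1.
  by move/eqP: det; rewrite sqrf_eq1 => /orP[] /eqP ->; rewrite ?normrN normr1.
(* The exact distance formula for a Mobius map of determinant 1 or -1. With the bounds on the
   denominators it gives both the contraction of psi towards x and its limited distortion. *)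
have psiB s t : 0 < s -> s < 1 -> 0 < t -> t < 1 ->
    `|s - t| = (c * s + d) * (c * t + d) * `|psi s - psi t|.
  move=> s0 s1 t0 t1; have ds := den_gt0 _ s0 s1; have dt := den_gt0 _ t0 t1.
  rewrite -[X in X * `|_|]ger0_norm ?mulr_ge0 ?ltW // -normrM.
  rewrite -[LHS]mul1r -det1 -normrM; congr `|_|.
  by rewrite /psi; field; rewrite !lt0r_neq0.
have C01 s : C s -> 0 < s /\ s < 1.
  by move=> [/EX /T2_space_sub01 + _]; rewrite /= in_itv /= => /andP[].
exists r; split => //.
  have h : 5 / (e * rho) < S.
    apply: lt_le_trans (archi_boundP _) _; first by rewrite divr_ge0 // mulr_ge0 // ltW.
    by apply: le_trans _ D; rewrite ler_nat (leq_trans Nn) // -addn2 leq_addr.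
  have {}h : 5 / (e * rho) < S ^+ 2 by apply: lt_le_trans h _; nra.
  rewrite ltr_pdivrMr in h; last by rewrite mulr_gt0.
  by rewrite /r ltr_pdivrMr ?mulr_gt0 ?exprn_gt0 //; lra.
(* The map psi sends [C] into [E] and, since the denominators at u and s are at least S / 5 and e S,
   within distance r of x = psi u. *)
have key : (lambda C <= (2 * S ^+ 2)%:E * lambda (E `&` ball x r))%E.
  apply: (@expanding_lebesgue_measure_le R psi) => //.
  - by rewrite exprn_gt0; lra.
  - move=> s t /C01[s0 s1] /C01[t0 t1]; rewrite psiB // ler_wpM2r // expr2.
    by apply: ler_pM; [exact/ltW/den_gt0|exact/ltW/den_gt0|exact: den_le|exact: den_le].
  - move=> _ [s Cs <-]; have [s0 s1] := C01 _ Cs.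
    split; first by apply: psiS => //; case: Cs.
    have [u0' u1'] : 0 < u /\ u < 1 by lra.
    have sD : e * S <= c * s + d.
      case: Cs => _; rewrite /exhaust /= in_itv /= -/e => /andP[h1 h2].
      by apply: den_ge; lra.
    have uD : 1 / 5 * S <= c * u + d by apply: den_ge; lra.
    rewrite -ball_normE /= {1}xE /r ltr_pdivlMr ?mulr_gt0 ?exprn_gt0 //.
    have := psiB _ _ u0' u1' s0 s1.
    have : `|u - s| < 1 by rewrite ltr_norml; lra.
    have : (1 / 5 * S) * (e * S) * `|psi u - psi s| <=
        (c * u + d) * (c * s + d) * `|psi u - psi s|.
      by rewrite ler_wpM2r // ler_pM // mulr_ge0; lra.
    by move=> h1 h2 h3; rewrite h3 in h2; have := le_lt_trans h1 h2; lra.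
have mball : measurable (E `&` ball x r) by apply: measurableI => //; exact: measurable_ball.
have ballE : lambda (ball x r) = (r *+ 2)%:E by rewrite lebesgue_measure_ball // ltW.
have wE : lambda (E `&` ball x r) = (fine (lambda (E `&` ball x r)))%:E.
  rewrite fineK // ge0_fin_numE //; apply: (@le_lt_trans _ _ (lambda (ball x r))).
    by apply: le_measure; rewrite ?inE //; exact: measurable_ball.
  by rewrite ballE ltry.
rewrite wE ballE -EFinM lee_fin; rewrite wE CE -EFinM lee_fin in key.
move: key; set w := fine _ => key.
have S20 : 0 < 2 * S ^+ 2 by rewrite mulr_gt0 // exprn_gt0 //; lra.
have -> : v * e / 20 * (r *+ 2) = v / (2 * S ^+ 2).
  by rewrite /r; field; rewrite !lt0r_neq0 //; lra.
by rewrite ler_pdivrMr // mulrC.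
Qed.

(** If neither [E] nor its complement is null, the Lebesgue density theorem provides a point x of
    the complement where [E] has density 0, whereas [invariant_density_bound] keeps the proportion
    of [E] above a fixed k > 0 in arbitrarily small balls around x. *)
Lemma mu_T2_ergodic : ergodic_measure (mu R) (T2_space R) (T2 R).
Proof.
move=> E mE EX EE.
have mX := @measurable_T2_space R.
have mB : measurable (T2_space R `\` E : set RR) by exact: measurableD.
have [E0|E0] := eqVneq (lambda E) 0%E; first by left; exact: mu_null.
right; apply: mu_null => //; apply/eqP; apply: contrapT => /negP B0.
have ES := invariant_backward_stable EX EE.
have E01 : E `<=` `]0, 1[%classic := subset_trans EX (@T2_space_sub01 R).
have [m m0] := measure_exhaust_neq0 mE E01 E0.
have [Z [mZ Z0 dZ]] := lebesgue_density mE.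
have [x [xX nxE] nxZ] : exists2 x, (T2_space R `\` E) x & ~ Z x.
  apply: contrapT => h; apply/negP: B0; rewrite negbK; apply/eqP.
  apply: (subset_measure0 mB mZ _ Z0) => x xB; apply: contrapT => xZ.
  by apply: h; exists x.
have [k k0 hk] := invariant_density_bound mE ES EX xX m0.
have cvg0 : (lambda (E `&` ball x r) * (lambda (ball x r))^-1)%E @[r --> 0^'+] -->
    (0%:E : \bar R).
  apply: contrapT => h; apply: nxZ; apply: dZ => /=.
  by rewrite indicE memNset.
have lt_k : \forall y \near nbhs (0%:E : \bar R), (y < k%:E)%E.
  by apply: open_nbhs_nbhs; split; [exact: open_ereal_lt_ereal|rewrite /= lte_fin].
have [rho /= rho0 hrho] := cvg0 _ lt_k.
have [r [r0 rrho kr]] := hk _ rho0.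
have := hrho r; rewrite /= sub0r normrN gtr0_norm // => /(_ rrho r0).
have ballE : lambda (ball x r) = (r *+ 2)%:E by rewrite lebesgue_measure_ball // ltW.
have r20 : 0 < r *+ 2 by rewrite mulr2n addr_gt0.
apply/negP; rewrite -leNgt; move: kr; rewrite ballE inver gt_eqF //.
by rewrite lee_pdivlMr.
Qed.

End Ergodicity.

Theorem theorem1p3 (R : realType) :
  [/\ matrix_generating_system genN base_triples F,
      well_defined_system (genNR R) /\
      conjugate_off_finite (FA R) (`]0, 1[ : set R)
        (corresponding_map (genNR R)) (T2 R) (pi_map R) (pi_map_inv R)
    & (@lebesgue_measure R).-negligible (`]0, 1[ `\` T2_space R) /\
      [/\ sigma_finite (`]0, 1[ : set (measurableTypeR R)) (mu R),
          invariant_measure (mu R) (T2_space R) (T2 R),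
          ergodic_measure (mu R) (T2_space R) (T2 R)
        & conservative_measure (mu R) (T2_space R) (T2 R)]].
Proof.
split; first exact: genN_generating.
  by split; [exact: genNR_system|exact: T2_conjugate].
split; first exact: negligible_T2_space.
split.
- exact: sigma_finite_mu.
- exact: mu_T2_invariant.
- exact: mu_T2_ergodic.
- exact: mu_T2_conservative.
Qed.
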